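(* Let $T$ be a Turing machine universal for the class of all Turing machines and let $s>1$ be a computable real. Then $\langle\kappa^n_{R(T)}\rangle(s)=\zeta_{R(T)}(s)/\zeta(s)$ is asymptotically $1/s$-random.
   Context: Turing machines map binary strings to binary strings (partial functions on $\Sigma^*$, $\Sigma=\{0,1\}$); $\mathrm{dom}(M)$ is the set of inputs on which $M$ halts. A machine $W$ is universal for a class $\Re$ if for every $C\in\Re$ there is $c\ge0$ such that for every $x\in\mathrm{dom}(C)$ there is $p_x\in\mathrm{dom}(W)$ with $|p_x|\le|x|+c$ and $W(p_x)=C(x)$. $\mathrm{bin}:\mathbf{N}=\{1,2,\dots\}\to\Sigma^*$ sends $n$ to its binary expansion with the leading 1 removed. For a Turing machine $M$ and real $s>1$, $\zeta_M(s)=\sum_{n\ge1,\ \mathrm{bin}(n)\in\mathrm{dom}(M)}n^{-s}$, and $\zeta(s)=\sum_{n\ge1}n^{-s}$ is the Riemann zeta function. Prime product machine: let $p_i$ be the $i$th prime, $P=\{p_i:\mathrm{bin}(i)\in\mathrm{dom}(M)\}$, $S=\{n\ge1:\text{all prime factors of } n \text{ lie in } P\}$; $R(M)$ is the Turing machine which on input $x$ computes $n=\mathrm{bin}^{-1}(x)$, factors $n$, simulates $M(\mathrm{bin}(i))$ for each prime factor $p_i$ of $n$, and then outputs the empty string; thus $\mathrm{dom}(R(M))=\mathrm{bin}(S)$. Plain complexity $K_T(x)=\min\{|w|:T(w)=x\}$; $\alpha[m]$ is the first $m$ bits of the unending binary expansion of $\alpha\in(0,1)$. For computable $s\ge1$,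 $\alpha$ is asymptotically $1/s$-random if for every computable real $t>s$ there is $c_t\ge0$ with $K_T(\alpha[m])\ge m/t-c_t$ for all $m\ge1$ (equivalently, $\liminf_{m\to\infty}K_T(\alpha[m])/m\ge 1/s$). *)

(* Defs.v *)
From HB Require Import structures.
From mathcomp Require Import all_boot all_order all_algebra.
From mathcomp Require Import all_classical all_reals all_analysis.

Set Implicit Arguments.
Unset Strict Implicit.
Unset Printing Implicit Defensive.

Import Order.TTheory GRing.Theory Num.Theory.
Import numFieldNormedType.Exports.
Local Open Scope classical_set_scope.
Local Open Scope ring_scope.

Notation string := (seq bool).

(* Partial functions on strings, given by their graphs. *)
Definition pfun := string -> string -> Prop.

Definition dom (f : pfun) : set string := [set x | exists y, f x y].

(* Deterministic Turing machines with finitely many (at least one) two-way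
   infinite tapes.  A cell is [None] (blank), [Some (inl b)] (the bit [b]) or
   [Some (inr a)] ([a] an auxiliary symbol).  The machine halts when the
   transition function returns [None]. *)
Inductive move := MoveLeft | MoveRight | Stay.

Definition cell (A : finType) : finType := option (bool + A)%type.

Record TM := {
  ntapes : nat;   (* number of tapes minus one *)
  alphabet : finType;
  state : finType;
  start : state;
  trans : state -> {ffun 'I_ntapes.+1 -> cell alphabet} ->
          option (state * {ffun 'I_ntapes.+1 -> cell alphabet * move})
}.

(* The pair [(l, r)] is the tape whose cells strictly left of the head are [l],
   read leftwards, and whose cells from the head rightwards are [r]; all the
   cells beyond the two lists are blank. *)
Definition tape (A : finType) : Type := seq (cell A) * seq (cell A).

Definition read (A : finType) (t : tape A) : cell A := head None t.2.

Definition write_move (A : finType) (t : tape A) (cm : cell A * move) : tape A :=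
  let: (l, r) := (t.1, cm.1 :: behead t.2) in
  match cm.2 with
  | MoveLeft => (behead l, head None l :: r)
  | MoveRight => (head None r :: l, behead r)
  | Stay => (l, r)
  end.

Definition config (M : TM) : Type :=
  state M * {ffun 'I_(ntapes M).+1 -> tape (alphabet M)}.

Definition step (M : TM) (c : config M) : option (config M) :=
  omap (fun qa : state M * {ffun 'I_(ntapes M).+1 -> cell (alphabet M) * move} =>
          (qa.1, [ffun i => write_move (c.2 i) (qa.2 i)]))
       (trans c.1 [ffun i => read (c.2 i)]).

(* The input is on the first tape, with the head on its first symbol. *)
Definition init (M : TM) (x : string) : config M :=
  (start M, [ffun i => if i == ord0
                       then ([::], [seq Some (inl b) | b <- x])
                       else ([::], [::])]).

Fixpoint leading_bits (A : finType) (r : seq (cell A)) : string :=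
  if r is Some (inl b) :: r' then b :: leading_bits r' else [::].

(* The output is the maximal block of bits of the first tape which starts at
   the head position (it is empty if the head does not scan a bit). *)
Definition output (M : TM) (c : config M) : string :=
  leading_bits (c.2 ord0).2.

Definition run (M : TM) (n : nat) (c : config M) : config M :=
  iter n (fun c => odflt c (step c)) c.

(* [computes M x y]: on input [x], the machine [M] halts with output [y]. *)
Definition computes (M : TM) : pfun := fun x y =>
  exists n, step (run n (init M x)) = None /\ output (run n (init M x)) = y.

Coercion computes : TM >-> pfun.

Definition universal (W : TM) (K : TM -> Prop) : Prop :=
  forall C, K C -> exists c : nat, forall x y, computes C x y ->
    exists p, (size p <= size x + c)%N /\ computes W p y.

(* [bin n] (for [n >= 1]): the binary digits of [n], most significant first,
   without the leading 1, which is the digit of rank [trunc_log 2 n]. *)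
Definition bin (n : nat) : string :=
  rev (mkseq (fun i => odd (n %/ 2 ^ i)%N) (trunc_log 2 n)).

Lemma next_prime_ex (n : nat) : exists p, (n < p)%N && prime p.
Proof. by case: (prime_above n) => p np pp; exists p; rewrite np pp. Qed.

Definition next_prime (n : nat) : nat := ex_minn (next_prime_ex n).

(* Primes are numbered from 1: [nth_prime 1 = 2], [nth_prime 2 = 3]... *)
Definition nth_prime (i : nat) : nat := iter i next_prime 0%N.

(* The prime product machine [R(M)], as a partial function: on input [bin n] it
   halts, with empty output, iff [M] halts on [bin i] for every [i >= 1] such
   that the [i]-th prime divides [n]. *)
Definition prime_product (M : pfun) : pfun := fun x y =>
  exists n, [/\ (0 < n)%N, x = bin n,
    forall i, (0 < i)%N -> (nth_prime i %| n)%N -> dom M (bin i) & y = [::]].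

Section Reals.
Context {R : realType}.
Implicit Types s t alpha : R.

Definition zeta s : R := limn (fun N => \sum_(1 <= n < N) n%:R `^ (- s)).

Definition zeta_of (M : pfun) s : R :=
  limn (fun N => \sum_(1 <= n < N | `[< dom M (bin n) >]) n%:R `^ (- s)).

(* The string [b :: bin a.+1] stands for the integer [(-1)^b * a], and the real
   number [r] is computable if some machine maps every [n >= 1] to an integer
   [z] such that [z / 2^n] is within [2^-n] of [r]. *)
Definition computable_real (r : R) : Prop :=
  exists M : TM, forall n, (0 < n)%N -> exists (b : bool) (a : nat),
    computes M (bin n) (b :: bin a.+1) /\
    `|r - (-1) ^+ b * a%:R / 2 ^+ n| <= 2 ^- n.

(* Plain complexity; it is [+oo] on strings which [T] does not output. *)
Definition complexity (T : pfun) (x : string) : \bar R :=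
  ereal_inf [set ((size w)%:R)%:E | w in [set w | T w x]].

(* [d] is the sequence of digits of the binary expansion of [alpha] which
   contains infinitely many ones. *)
Definition unending_expansion alpha (d : nat -> bool) : Prop :=
  (forall i, exists2 j, (i <= j)%N & d j) /\
  (series (fun i => (d i)%:R / 2 ^+ i.+1 : R) @ \oo --> alpha).

(* Asymptotic 1/s-randomness, with respect to [T], of a real in (0, 1); the
   prefix [mkseq d m] consists of the first [m] digits. *)
Definition asymptotically_random (T : pfun) s alpha : Prop :=
  0 < alpha < 1 /\
  exists2 d, unending_expansion alpha d &
    forall t, computable_real t -> s < t ->
    exists2 c : R, 0 <= c & forall m, (0 < m)%N ->
      ((m%:R / t - c)%:E <= complexity T (mkseq d m))%E.

End Reals.

(* Main.v *)
From HB Require Import structures.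
Require Import Defs.
From mathcomp Require Import all_boot all_order all_algebra.
From mathcomp Require Import all_classical all_reals all_analysis.
From mathcomp Require Import zify ring lra.

(* The number [alpha = zeta_of (prime_product T) s / zeta s] compares the sum of
   [n^-s] over the set [S] of the integers whose prime factors [p_i] all satisfy
   [bin i \in dom T] with the sum over all the integers.  Given the first [m]
   digits [0.x] of [alpha], enumerate [S] until the part found has a sum greater
   than [0.x * zeta s]: the rest of [S] then has a sum at most [2^-m * zeta s].
   If [T] halts on [bin i] but this was not yet observed, the prime [p_i] belongs
   to that rest, so [p_i^-s <= 2^-m * zeta s]; as [p_i] is [i] up to a
   logarithmic factor (Chebyshev), [bin i] has length at least [m / t - c] for
   [t > s].  The search thus yields all outputs of [T] on shorter inputs, hence a
   string of complexity at least [m / t - c].  By universality a program for the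
   prefix of [alpha] cannot be much shorter.

   The search has to be run by a Turing machine.  Programs over registers holding
   bit strings are compiled to Turing machines, and functions computed by such
   programs are shown to be closed under the constructions needed, including the
   simulation of a given machine. *)

Set Implicit Arguments.
Unset Strict Implicit.
Unset Printing Implicit Defensive.

(** * Register programs and their compilation to Turing machines *)

(** The search halts only on genuine prefixes of [alpha], while Rocq functions are total. Its inputs
    therefore form a type, [output_prefix], whose elements are programs of [T] for such prefixes; a
    function on a type counts as computable when some program is correct on the codes of its
    elements, whatever it does on other strings. Coding an element by its program alone makes
    [size (encode a)] the quantity to bound from below. The strict inequality [0.x < alpha], without
    which the search might not end, is what the expansion with infinitely many ones provides. The
    test also needs upper bounds for [zeta s]: some [h] with [1 + 1/h <= s] is fixed, and summing up
    to [L^h] leaves a tail of at most [h/L]. Every [n^-s] is replaced by dyadic bounds, so that the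
    test compares natural numbers. That [alpha < 1] is not automatic: it rests on a universal
    machine failing to halt on some input. *)

Definition store := nat -> string.

Definition upd (st : store) (k : nat) (x : string) : store :=
  fun r => if r == k then x else st r.

Inductive prog :=
  | Skip
  | Push of nat & bool
  | Seq of prog & prog
  | Case of nat & prog & prog & prog
  | While of nat & prog.

(** These structures allow the finite type [seq_sub L] of continuations to be the set of states of a
    machine. *)
HB.instance Definition _ := gen_eqMixin prog.
HB.instance Definition _ := gen_choiceMixin prog.

Inductive exec : prog -> store -> store -> Prop :=
  | exec_skip st : exec Skip st st
  | exec_push r b st : exec (Push r b) st (upd st r (b :: st r))
  | exec_seq p q st st1 st2 : exec p st st1 -> exec q st1 st2 ->
      exec (Seq p q) st st2
  | exec_case_nil r p p0 p1 st st' : st r = [::] -> exec p st st' ->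
      exec (Case r p p0 p1) st st'
  | exec_case_cons r p p0 p1 st st' b x : st r = b :: x ->
      exec (if b then p1 else p0) (upd st r x) st' ->
      exec (Case r p p0 p1) st st'
  | exec_while_nil r p st : st r = [::] -> exec (While r p) st st
  | exec_while_cons r p st st1 st2 : st r <> [::] -> exec p st st1 ->
      exec (While r p) st1 st2 -> exec (While r p) st st2.

Fixpoint regs_below (n : nat) (p : prog) : bool :=
  match p with
  | Skip => true
  | Push r _ => r < n
  | Seq p q => regs_below n p && regs_below n q
  | Case r p p0 p1 =>
      [&& r < n, regs_below n p, regs_below n p0 & regs_below n p1]
  | While r p => (r < n) && regs_below n p
  end.

Lemma regs_below_le m n p : m <= n -> regs_below m p -> regs_below n p.
Proof.
move=> mn; elim: p => //=.
- by move=> r _ /leq_trans; apply.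
- by move=> p IHp q IHq /andP[/IHp-> /IHq->].
- move=> r p IHp p0 IH0 p1 IH1 /and4P[/leq_trans-> // /IHp-> /IH0->].
  by move=> /IH1->.
- by move=> r p IHp /andP[/leq_trans-> // /IHp->].
Qed.

Lemma regs_below_ex p : exists n, regs_below n.+1 p.
Proof.
elim: p => [|r b|p [n IHp] q [m IHq]|r p [n IHp] p0 [n0 IH0] p1 [n1 IH1]|r p [n IHp]].
- by exists 0.
- by exists r => /=.
- exists (n + m) => /=.
  by rewrite (regs_below_le _ IHp) ?(regs_below_le _ IHq) //; lia.
- exists (r + n + n0 + n1) => /=.
  rewrite (regs_below_le _ IHp) ?(regs_below_le _ IH0) ?(regs_below_le _ IH1) //; lia.
- exists (r + n) => /=; rewrite (regs_below_le _ IHp) //; lia.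
Qed.

(* The control states of the machine running a program are the lists of
   programs still to be run; [conts p k] lists those met from [p :: k] on,
   before [k] is reached. *)
Fixpoint conts (p : prog) (k : seq prog) : seq (seq prog) :=
  (p :: k) :: match p with
  | Seq p q => conts p (q :: k) ++ conts q k
  | Case r p p0 p1 => conts p k ++ conts p0 k ++ conts p1 k
  | While r p' => conts p' (p :: k)
  | _ => [::]
  end.

Lemma head_conts p k : p :: k \in conts p k.
Proof. by case: p => *; rewrite inE eqxx. Qed.

Definition void_cell := cell void.

Section Compile.
Variables (n : nat) (L : seq (seq prog)) (p0 : seq prog) (hp0 : p0 \in L).

Let ctl : finType := (bool * seq_sub L)%type.
Let tapes (A : Type) := {ffun 'I_n.+1 -> A}.

Definition act1 (rd : tapes void_cell) (r : nat) (c : void_cell) (m : move) :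
  tapes (void_cell * move)%type :=
  [ffun i : 'I_n.+1 => if i == r :> nat then (c, m) else (rd i, Stay)].

Definition act0 (rd : tapes void_cell) : tapes (void_cell * move)%type :=
  [ffun i : 'I_n.+1 => (rd i, Stay)].

(** A continuation outside [L] would halt the machine; the membership hypotheses of [simulation]
    exclude this. *)
Definition goto (f : bool) (k : seq prog) (w : tapes (void_cell * move)%type) :
  option (ctl * tapes (void_cell * move)%type) :=
  omap (fun c => ((f, c), w)) (insub k).

(* A push takes two steps (move left, then write); the boolean distinguishes
   the second one. *)
Definition ctrans (q : ctl) (rd : tapes void_cell) :
  option (ctl * tapes (void_cell * move)%type) :=
  match val q.2 with
  | [::] => None
  | Skip :: k => goto false k (act0 rd)
  | Push r b :: k =>
      if q.1 then goto false k (act1 rd r (Some (inl b)) Stay)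
      else goto true (Push r b :: k) (act1 rd r (rd (inord r)) MoveLeft)
  | Seq p q :: k => goto false (p :: q :: k) (act0 rd)
  | Case r p p0 p1 :: k =>
      if rd (inord r) is Some (inl b) then
        goto false ((if b then p1 else p0) :: k) (act1 rd r None MoveRight)
      else goto false (p :: k) (act0 rd)
  | While r p :: k =>
      if rd (inord r) is Some _ then goto false (p :: While r p :: k) (act0 rd)
      else goto false k (act0 rd)
  end.

Definition machine : TM :=
  {| ntapes := n; alphabet := void; state := ctl; start := (false, SeqSub hp0);
     trans := ctrans |}.

(** A tape is used as a stack with its top under the head. The blanks [i] and [j] absorb the cells
    that pops leave on the left and that moves create on the right. *)
Definition holds_tape (t : tape void) (x : string) : Prop :=
  exists i j, t = (nseq i None, [seq Some (inl b) | b <- x] ++ nseq j None).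

Definition holds (c : config machine) (f : bool) (k : seq prog) (st : store) :=
  [/\ c.1.1 = f, val c.1.2 = k & forall i : 'I_n.+1, holds_tape (c.2 i) (st i)].

Lemma holds_read t x : holds_tape t x ->
  read t = if x is b :: _ then Some (inl b) else None.
Proof. by move=> [i [j ->]]; rewrite /read; case: x => //=; case: j. Qed.

(** Writing back what was read may still turn an empty list of cells into an explicit blank, hence
    the change of [j]. *)
Lemma holds_stay t x : holds_tape t x -> holds_tape (write_move t (read t, Stay)) x.
Proof.
move=> [i [j ->]]; rewrite /write_move /read /=.
case: x => [|b x] /=; last by exists i, j.
by case: j => [|j]; exists i; [exists 1|exists j.+1].
Qed.

Lemma holds_pop t b x : holds_tape t (b :: x) ->
  holds_tape (write_move t (None, MoveRight)) x.
Proof. by move=> [i [j ->]]; exists i.+1, j. Qed.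

(** The state between the two steps of a push: the head is on the blank cell just before the
    string. *)
Definition pushing (t : tape void) (x : string) : Prop :=
  exists i j, t = (nseq i None, None :: [seq Some (inl b) | b <- x] ++ nseq j None).

Lemma holds_push1 t x : holds_tape t x ->
  pushing (write_move t (read t, MoveLeft)) x.
Proof.
move=> [i [j ->]]; rewrite /write_move /read /=.
have -> : head None (nseq i None) = None :> void_cell by case: i.
have -> : behead (nseq i (None : void_cell)) = nseq i.-1 None by case: i.
case: x => [|b x] /=; last by exists i.-1, j.
by case: j => [|j]; exists i.-1; [exists 1|exists j.+1].
Qed.

Lemma holds_push2 t b x : pushing t x ->
  holds_tape (write_move t (Some (inl b), Stay)) (b :: x).
Proof. by move=> [i [j ->]]; exists i, j. Qed.

Definition reach (c c' : config machine) := exists m, run m c = c'.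

Lemma reach_trans c1 c2 c3 : reach c1 c2 -> reach c2 c3 -> reach c1 c3.
Proof.
move=> [m <-] [m' <-]; exists (m' + m); exact: iterD.
Qed.

Lemma reach_step c c' : step c = Some c' -> reach c c'.
Proof. by move=> h; exists 1; rewrite /run /= h. Qed.

Definition scan (c : config machine) : tapes void_cell := [ffun i => read (c.2 i)].

Lemma reach_goto c f k w : k \in L ->
  ctrans c.1 (scan c) = goto f k w ->
  exists c', [/\ reach c c', c'.1.1 = f, val c'.1.2 = k &
     forall i, c'.2 i = write_move (c.2 i) (w i)].
Proof.
move=> kL; rewrite /goto (insubT (mem L) kL) /= => h.
pose c' : config machine :=
  ((f, SeqSub kL) : ctl, [ffun i => write_move (c.2 i) (w i)]).
exists c'; split=> //.
  by apply: reach_step; rewrite /step /= -/(scan c) h.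
by move=> i; rewrite ffunE.
Qed.

Lemma holds_act0 (c : config machine) st :
  (forall i : 'I_n.+1, holds_tape (c.2 i) (st i)) ->
  forall i : 'I_n.+1, holds_tape (write_move (c.2 i) (act0 (scan c) i)) (st i).
Proof. by move=> h i; rewrite !ffunE; exact: holds_stay. Qed.

Lemma read_holds c f k st r : holds c f k st -> r < n.+1 ->
  scan c (inord r) =
  if st r is b :: _ then Some (inl b) else None.
Proof. by move=> [_ _ h] rn; rewrite ffunE (holds_read (h _)) inordK. Qed.

(** Induction on the execution. The continuation [k] is general, so that the hypothesis for a
    component applies with the rest of the program put in front of [k]. *)
Lemma simulation p st st' : exec p st st' -> regs_below n.+1 p ->
  forall k c, k \in L -> {subset conts p k <= L} -> holds c false (p :: k) st ->
  exists2 c', reach c c' & holds c' false k st'.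
Proof.
elim=> {p st st'}.
- move=> st _ k c kL sL [c1 c2 c3].
  have [|c' [h1 h2 h3 h4]] := @reach_goto c false k (act0 (scan c)) kL.
    by rewrite /= /ctrans c2.
  by exists c' => //; split=> // i; rewrite h4; exact: (holds_act0 c3).
- move=> r b st /= rn k c kL sL [c1 c2 c3].
  have pL : Push r b :: k \in L by apply: sL; exact: head_conts.
  have [|c' [h1 h2 h3 h4]] := @reach_goto c true (Push r b :: k)
    (act1 (scan c) r ((scan c) (inord r)) MoveLeft) pL.
    by rewrite /= /ctrans c2 c1.
  have [|c'' [g1 g2 g3 g4]] := @reach_goto c' false k
    (act1 (scan c') r (Some (inl b)) Stay) kL.
    by rewrite /= /ctrans h3 h2.
  exists c''; first exact: reach_trans h1 g1.
  split=> // i; rewrite g4 ffunE /upd.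
  have := h4 i; rewrite ffunE.
  case: eqP => [ir|_].
    rewrite ffunE => ->; apply: holds_push2.
    have -> : inord r = i by apply/val_inj; rewrite /= inordK.
    by rewrite -ir; apply: holds_push1.
  by move=> e; rewrite ffunE; apply: holds_stay; rewrite e ffunE; apply: holds_stay.
- move=> p q st st1 st2 _ IHp _ IHq /= /andP[wp wq] k c kL sL [c1 c2 c3].
  have qL : q :: k \in L.
    by apply: sL; rewrite /= inE mem_cat head_conts !orbT.
  have pL : p :: q :: k \in L.
    by apply: sL; rewrite /= inE mem_cat head_conts !orbT.
  have [|c' [h1 h2 h3 h4]] := @reach_goto c false _ (act0 (scan c)) pL.
    by rewrite /= /ctrans c2.
  have [||| d1 r1 hd1] := IHp wp (q :: k) c' => //.
  + by move=> x xp; apply: sL; rewrite /= inE mem_cat xp !orbT.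
  + by split=> // i; rewrite h4; exact: (holds_act0 c3).
  have [||| d2 r2 hd2] := IHq wq k d1 => //.
  + by move=> x xp; apply: sL; rewrite /= inE mem_cat xp !orbT.
  by exists d2 => //; apply: reach_trans h1 (reach_trans r1 r2).
- move=> r p q0 q1 st st' str _ IH /= /and4P[rn wp w0 w1] k c kL sL hc.
  have [c1 c2 c3] := hc.
  have pL : p :: k \in L.
    by apply: sL; rewrite /= inE mem_cat head_conts !orbT.
  have [|c' [h1 h2 h3 h4]] := @reach_goto c false _ (act0 (scan c)) pL.
    by rewrite /= /ctrans c2 (read_holds hc rn) str.
  have [||| d1 r1 hd1] := IH wp k c' => //.
  + by move=> x xp; apply: sL; rewrite /= inE mem_cat xp !orbT.
  + by split=> // i; rewrite h4; exact: (holds_act0 c3).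
  by exists d1 => //; apply: reach_trans h1 r1.
- move=> r p q0 q1 st st' b x str _ IH /= /and4P[rn wp w0 w1] k c kL sL hc.
  have [c1 c2 c3] := hc.
  have pL : (if b then q1 else q0) :: k \in L.
    by apply: sL; rewrite /= inE !mem_cat; case: (b); rewrite head_conts !orbT.
  have [|c' [h1 h2 h3 h4]] := @reach_goto c false _
    (act1 (scan c) r None MoveRight) pL.
    by rewrite /= /ctrans c2 (read_holds hc rn) str.
  have [|||| d1 r1 hd1] := IH _ k c' => //.
  + by case: (b).
  + by move=> y yp; apply: sL; rewrite /= inE !mem_cat; case: (b) yp => ->; rewrite !orbT.
  + split=> // i; rewrite h4 ffunE /upd; case: eqP => [ir|_].
      by apply: (@holds_pop _ b); rewrite -str -ir.
    by rewrite ffunE; apply: holds_stay.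
  by exists d1 => //; apply: reach_trans h1 r1.
- move=> r p st str /= /andP[rn wp] k c kL sL hc.
  have [c1 c2 c3] := hc.
  have [|c' [h1 h2 h3 h4]] := @reach_goto c false _ (act0 (scan c)) kL.
    by rewrite /= /ctrans c2 (read_holds hc rn) str.
  by exists c' => //; split=> // i; rewrite h4; exact: (holds_act0 c3).
- move=> r p st st1 st2 str _ IHp _ IHw /= /andP[rn wp] k c kL sL hc.
  have [c1 c2 c3] := hc.
  have wL : While r p :: k \in L by apply: sL; exact: head_conts.
  have pL : p :: While r p :: k \in L.
    by apply: sL; rewrite /= inE head_conts !orbT.
  have [|c' [h1 h2 h3 h4]] := @reach_goto c false _ (act0 (scan c)) pL.
    by rewrite /= /ctrans c2 (read_holds hc rn); case: (st r) str.
  have [||| d1 r1 hd1] := IHp wp (While r p :: k) c' => //.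
  + by move=> x xp; apply: sL; rewrite /= inE xp !orbT.
  + by split=> // i; rewrite h4; exact: (holds_act0 c3).
  have wrp : (r < n.+1) && regs_below n.+1 p by rewrite rn wp.
  have [d2 r2 hd2] := IHw wrp k d1 kL sL hd1.
  by exists d2 => //; apply: reach_trans h1 (reach_trans r1 r2).
Qed.

End Compile.

(** The empty continuation is the halting state, and register 0 is the first tape, used for both
    input and output. *)
Lemma exec_computable p : exists C : TM, forall x y st,
  exec p (upd (fun=> [::]) 0 x) st -> st 0 = y -> computes C x y.
Proof.
have [n wp] := regs_below_ex p.
have hL : [:: p] \in [::] :: conts p [::] by rewrite inE head_conts orbT.
exists (machine n hL) => x y st /simulation/(_ wp) h <-.
have [|||c' [m hm] [h1 h2 h3]] := h _ _ hL [::] (init (machine n hL) x).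
- by rewrite inE eqxx.
- by move=> k kp; rewrite inE kp orbT.
- split=> // i; rewrite ffunE /upd.
  case: eqP => [->|ni] /=; first by exists 0, 0; rewrite cats0.
  case: eqP => [i0|_]; first by case: ni; apply: val_inj.
  by exists 0, 0.
exists m; rewrite hm; split; first by rewrite /step /= /ctrans h2.
rewrite /output; have [i [j /= ->]] := h3 ord0.
by elim: (st _) => [|b z /= ->] //; case: j.
Qed.

(** * Functions computed by register programs *)

Ltac store_eq :=
  let z := fresh "z" in
  apply/funext => z; rewrite /upd /=;
  repeat match goal with
  | |- context [?a == ?b :> nat] => case: (@eqP _ a b) => ?; try lia; subst
  end; try done.

Ltac upd_at :=
  rewrite /upd /=;
  repeat match goal with
  | |- context [?a == ?b :> nat] => case: (@eqP _ a b) => ?; try lia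
  end; try done.

Lemma exec_to p st st1 st2 : exec p st st1 -> st1 = st2 -> exec p st st2.
Proof. by move=> h <-. Qed.

Lemma exec_from p st0 st st' : exec p st st' -> st0 = st -> exec p st0 st'.
Proof. by move=> h ->. Qed.

Definition Drain r p0 p1 := While r (Case r Skip p0 p1).

(** In the invariant [I d x], the string [x] is what remains in register [r], and [d] is what was
    already popped, last bit first. *)
Lemma exec_drain r p0 p1 (I : string -> string -> store) :
  (forall d x, I d x r = x) ->
  (forall d b x, exec (if b then p1 else p0) (upd (I d (b :: x)) r x)
                      (I (b :: d) x)) ->
  forall d x, exec (Drain r p0 p1) (I d x) (I (catrev x d) [::]).
Proof.
move=> hI hp d x; elim: x d => [|b x IH] d /=.
  by apply: exec_while_nil; rewrite hI.
apply: (exec_while_cons _ _ (IH _)); first by rewrite hI.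
by apply: (@exec_case_cons _ _ _ _ _ _ b x); rewrite ?hI.
Qed.

Definition Clear r := Drain r Skip Skip.

Lemma exec_clear r st : exec (Clear r) st (upd st r [::]).
Proof.
apply: exec_from (@exec_drain r _ _ (fun _ x => upd st r x) _ _ [::] (st r)) _.
- by move=> d x; rewrite /upd eqxx.
- move=> d b x; have -> : (if b then Skip else Skip) = Skip by case: b.
  by apply: exec_to (exec_skip _) _; store_eq.
- by store_eq.
Qed.

(** The string arrives reversed; two moves restore the order. *)
Definition Move r1 r2 := Drain r1 (Push r2 false) (Push r2 true).

Lemma exec_move r1 r2 st : r1 <> r2 ->
  exec (Move r1 r2) st (upd (upd st r2 (catrev (st r1) (st r2))) r1 [::]).
Proof.
move=> r12.
apply: exec_from (@exec_drain r1 _ _ (fun d x => upd (upd st r2 d) r1 x)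
  _ _ (st r2) (st r1)) _.
- by move=> d x; rewrite /upd eqxx.
- move=> d b x; have -> : (if b then Push r2 true else Push r2 false) = Push r2 b.
    by case: b.
  by apply: exec_to (exec_push _ _ _) _; store_eq.
- by store_eq.
Qed.

Definition Copy r1 r2 r3 := Seq (Move r1 r3)
  (Drain r3 (Seq (Push r1 false) (Push r2 false)) (Seq (Push r1 true) (Push r2 true))).

Lemma exec_copy r1 r2 r3 st : r1 <> r2 -> r1 <> r3 -> r2 <> r3 ->
  st r2 = [::] -> st r3 = [::] ->
  exec (Copy r1 r2 r3) st (upd st r2 (st r1)).
Proof.
move=> r12 r13 r23 s2 s3.
apply: exec_seq (exec_move _ r13) _.
apply: exec_to; first apply: exec_from.
- apply: (@exec_drain r3 _ _ (fun d x => upd (upd (upd st r1 d) r2 d) r3 x)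
    _ _ [::] (catrev (st r1) [::])).
  + by move=> d x; rewrite /upd eqxx.
  + move=> d b x.
    have -> : (if b then Seq (Push r1 true) (Push r2 true)
               else Seq (Push r1 false) (Push r2 false)) =
              Seq (Push r1 b) (Push r2 b) by case: b.
    apply: exec_seq (exec_push _ _ _) _.
    by apply: exec_to (exec_push _ _ _) _; store_eq.
- by rewrite s3; store_eq.
- by rewrite !catrevE !cats0 revK; store_eq.
Qed.

(** A self-delimiting code: [true] announces a bit and [false] the end, so a pair can be split after
    concatenation. *)
Fixpoint dbl (x : string) : string :=
  if x is b :: x' then true :: b :: dbl x' else [:: false].

Definition Join k r1 r2 := Seq (Move r1 r2) (Seq (Push k false)
  (Drain r2 (Seq (Push k false) (Push k true)) (Seq (Push k true) (Push k true)))).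

Lemma exec_join k r1 r2 st : k <> r1 -> k <> r2 -> r1 <> r2 -> st r2 = [::] ->
  exec (Join k r1 r2) st (upd (upd st k (dbl (st r1) ++ st k)) r1 [::]).
Proof.
move=> kr1 kr2 r12 s2.
apply: exec_seq (exec_move _ r12) _.
apply: exec_seq (exec_push _ _ _) _.
apply: exec_to; first apply: exec_from.
- apply: (@exec_drain r2 _ _
    (fun d x => upd (upd (upd st k (dbl d ++ st k)) r1 [::]) r2 x)
    _ _ [::] (catrev (st r1) [::])).
  + by move=> d x; rewrite /upd eqxx.
  + move=> d b x.
    have -> : (if b then Seq (Push k true) (Push k true)
               else Seq (Push k false) (Push k true)) =
              Seq (Push k b) (Push k true) by case: b.
    apply: exec_seq (exec_push _ _ _) _.
    by apply: exec_to (exec_push _ _ _) _; store_eq.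
- by rewrite s2; store_eq.
- by rewrite !catrevE !cats0 revK; store_eq.
Qed.

(** Register [r1] is the flag of the loop: the end marker [false] pops it, while the marker [true]
    sends the next bit to [r2], where the first component arrives reversed. *)
Definition Split k r1 r2 := Seq (Push r1 true)
  (While r1 (Case k Skip (Case r1 Skip Skip Skip)
                 (Case k Skip (Push r2 false) (Push r2 true)))).

Lemma exec_split k r1 r2 st x y : k <> r1 -> k <> r2 -> r1 <> r2 ->
  st k = dbl x ++ y -> st r1 = [::] -> 
  exec (Split k r1 r2) st (upd (upd st k y) r2 (catrev x (st r2))).
Proof.
move=> kr1 kr2 r12 sk s1.
apply: exec_seq (exec_push _ _ _) _; rewrite s1.
have : upd st r1 [:: true] k = dbl x ++ y.
  by rewrite /upd; case: eqP.
have : upd st r1 [:: true] r1 = [:: true] by rewrite /upd eqxx.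
have -> : upd (upd st k y) r2 (catrev x (st r2)) =
  upd (upd (upd (upd st r1 [:: true]) k y) r1 [::]) r2
      (catrev x ((upd st r1 [:: true]) r2)).
  by store_eq; rewrite ?s1.
move: {sk s1}(upd st r1 _) => {}st.
elim: x st => [|b x IH] st /= s1 sk.
  apply: exec_while_cons; first by rewrite s1.
    apply: exec_case_cons; first exact: sk.
    apply: (@exec_case_cons _ _ _ _ _ _ true [::]); last exact: exec_skip.
    by rewrite /upd; case: eqP => // ?; lia.
  apply: exec_to; first apply: exec_while_nil; first by rewrite /upd eqxx.
  by store_eq.
apply: exec_while_cons; first by rewrite s1.
  apply: exec_case_cons; first exact: sk.
  apply: (@exec_case_cons _ _ _ _ _ _ b (dbl x ++ y)); first by rewrite /upd eqxx.
  have -> : (if b then Push r2 true else Push r2 false) = Push r2 b.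
    by case: (b).
  exact: exec_push.
apply: exec_to; first apply: IH.
- by upd_at.
- by upd_at.
by store_eq.
Qed.

Fixpoint Pushes k (x : string) : prog :=
  if x is b :: x' then Seq (Pushes k x') (Push k b) else Skip.

Lemma exec_pushes k x st : exec (Pushes k x) st (upd st k (x ++ st k)).
Proof.
elim: x st => [|b x IH] st /=.
  by apply: exec_to (exec_skip _) _; store_eq.
apply: exec_seq (IH _) _; apply: exec_to (exec_push _ _ _) _; store_eq.
Qed.

Class enc (A : Type) := Enc { encode : A -> string }.

#[export] Instance enc_bool : enc bool := Enc (fun b => [:: b]).
(** Running times do not matter, so numbers are unary; successor and predecessor then act on codes
    as [Some] and its removal. *)
#[export] Instance enc_nat : enc nat := Enc (fun n => nseq n true).
#[export] Instance enc_prod A B (eA : enc A) (eB : enc B) : enc (A * B) :=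
  Enc (fun p => dbl (encode p.1) ++ encode p.2).
#[export] Instance enc_option A (eA : enc A) : enc (option A) :=
  Enc (fun o => if o is Some a then true :: encode a else [::]).
Fixpoint encode_seq A (eA : enc A) (s : seq A) : string :=
  if s is a :: s' then dbl (encode a) ++ encode_seq eA s' else [::].
#[export] Instance enc_seq A (eA : enc A) : enc (seq A) := Enc (encode_seq eA).

(* Strings encoded by themselves, for input and output. *)
Record raw := Raw { unraw : string }.
#[export] Instance enc_raw : enc raw := Enc unraw.

(* The programs computing a function use only the registers from [k] on, and
   leave the scratch registers beyond [k] empty. *)
Definition cmp A B {eA : enc A} {eB : enc B} (f : A -> B) : Prop :=
  forall k, exists p, forall a st, st k = encode a ->
    (forall r, k < r -> st r = [::]) -> exec p st (upd st k (encode (f a))).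

Lemma cmp_computable A (eA : enc A) (f : A -> raw) : cmp f ->
  exists C : TM, forall a, computes C (encode a) (unraw (f a)).
Proof.
move=> /(_ 0)[p hp]; have [C hC] := exec_computable p.
exists C => a; apply: hC; first apply: (hp a); rewrite /upd ?eqxx //.
by case.
Qed.

(** A program for [f] overwrites its argument; here the argument survives in register [k] for
    further use. *)
Lemma cmp_copy A B (eA : enc A) (eB : enc B) (f : A -> B) : cmp f -> forall k j, k < j ->
  exists p, forall a st, st k = encode a -> (forall r, j <= r -> st r = [::]) ->
  exec p st (upd st j (encode (f a))).
Proof.
move=> hf k j kj; have [p hp] := hf j.
exists (Seq (Copy k j j.+1) p) => a st hk hr.
apply: exec_seq (exec_copy _ _ _ _ _) _; try lia; try (by apply: hr; lia).
apply: exec_to; first apply: (hp a).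
- by upd_at.
- by move=> r jr; upd_at; rewrite hr //; lia.
by store_eq.
Qed.

Section Closure.
Context {A B C D : Type} {eA : enc A} {eB : enc B} {eC : enc C} {eD : enc D}.

Lemma cmp_ext (f g : A -> B) : f =1 g -> cmp f -> cmp g.
Proof. by move=> /funext->. Qed.

Lemma cmp_code (f : A -> B) : (forall a, encode (f a) = encode a) -> cmp f.
Proof.
move=> h k; exists Skip => a st hk _; apply: exec_to (exec_skip _) _.
by rewrite h -hk; store_eq.
Qed.

Lemma cmp_comp (g : B -> C) (f : A -> B) : cmp g -> cmp f ->
  cmp (fun a => g (f a)).
Proof.
move=> hg hf k; have [p hp] := hf k; have [q hq] := hg k.
exists (Seq p q) => a st hk hr; apply: exec_seq (hp a _ hk hr) _.
apply: exec_to; first apply: (hq (f a)).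
- by upd_at.
- by move=> r kr; upd_at; exact: hr.
by store_eq.
Qed.

Lemma cmp_const (b : B) : cmp (fun _ : A => b).
Proof.
move=> k; exists (Seq (Clear k) (Pushes k (encode b))) => a st _ _.
apply: exec_seq (exec_clear _ _) _; apply: exec_to (exec_pushes _ _ _) _.
by store_eq; rewrite cats0.
Qed.

Lemma cmp_pair (f : A -> B) (g : A -> C) : cmp f -> cmp g ->
  cmp (fun a => (f a, g a)).
Proof.
move=> hf hg k.
have [p hp] := cmp_copy hf (leqnn k.+1).
have [q hq] := cmp_copy hg (leqnSn k.+1).
(* The code of [g a] reaches register [k] after two reversals, and [Join] puts the delimited code of
   [f a] before it. *)
exists (Seq p (Seq q (Seq (Clear k) (Seq (Move k.+2 k.+3)
  (Seq (Move k.+3 k) (Join k k.+1 k.+2)))))) => a st hk hr.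
apply: exec_seq; first exact: (hp a).
apply: exec_seq; first apply: (hq a).
- by upd_at.
- by move=> r jr; upd_at; rewrite hr //; lia.
apply: exec_seq (exec_clear _ _) _.
apply: exec_seq; first by apply: exec_move; lia.
apply: exec_seq; first by apply: exec_move; lia.
apply: exec_to; first (apply: exec_join; try lia).
- by upd_at.
have h3 : st k.+3 = [::] by apply: hr; lia.
by store_eq; rewrite ?h3 ?catrevE ?cats0 ?revK ?hr.
Qed.

Lemma cmp_if (c : A -> bool) (f g : A -> B) : cmp c -> cmp f -> cmp g ->
  cmp (fun a => if c a then f a else g a).
Proof.
move=> hc hf hg k; have [p hp] := hf k; have [q hq] := hg k.
have [t ht] := cmp_copy hc (leqnn k.+1).
exists (Seq t (Case k.+1 Skip q p)) => a st hk hr.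
have st1 : upd (upd st k.+1 [:: c a]) k.+1 [::] = st by store_eq; rewrite hr.
apply: (@exec_seq _ _ _ (upd st k.+1 [:: c a])).
  exact: (ht a).
apply: exec_case_cons; first by rewrite /upd eqxx.
by rewrite st1; case: (c a); [apply: (hp a)|apply: (hq a)].
Qed.

Lemma cmp_option (o : A -> option B) (g : A -> C) (h : A -> B -> C) :
  cmp o -> cmp g -> cmp (fun p : B * A => h p.2 p.1) ->
  cmp (fun a => if o a is Some b then h a b else g a).
Proof.
move=> ho hg hh k; have [p hp] := hg k; have [q hq] := hh k.
have [t ht] := cmp_copy ho (leqnn k.+1).
(* [Case] removes the tag of [Some b]; joining what is left in front of the code of [a] yields the
   code of [(b, a)]. *)
exists (Seq t
  (Case k.+1 p p (Seq (Join k k.+1 k.+2) q))) => a st hk hr.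
apply: (@exec_seq _ _ _ (upd st k.+1 (encode (o a)))).
  exact: (ht a).
case: (o a) => [b|] /=.
  apply: exec_case_cons; first by rewrite /upd eqxx.
  apply: exec_seq.
    apply: exec_join; try lia.
    by upd_at; rewrite hr.
  apply: exec_to; first apply: (hq (b, a)).
  - by upd_at; rewrite hk.
  - by move=> r kr; upd_at; rewrite ?hr.
  by store_eq; rewrite hr.
apply: exec_case_nil; first by rewrite /upd eqxx.
have -> : upd st k.+1 [::] = st by store_eq; rewrite hr.
exact: (hp a).
Qed.

Lemma cmp_fst0 : cmp (@fst A B).
Proof.
move=> k; exists (Seq (Split k k.+1 k.+2) (Seq (Clear k) (Move k.+2 k))).
move=> [a b] st hk hr.
have h1 : st k.+1 = [::] by apply: hr; lia.
have h2 : st k.+2 = [::] by apply: hr; lia.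
apply: exec_seq; first (apply: (exec_split _ _ _ hk h1); lia).
apply: exec_seq (exec_clear _ _) _.
apply: exec_to; first (apply: exec_move; lia).
by rewrite /=; store_eq; rewrite ?h2 ?catrevE ?cats0 ?revK.
Qed.

Lemma cmp_snd0 : cmp (@snd A B).
Proof.
move=> k; exists (Seq (Split k k.+1 k.+2) (Clear k.+2)).
move=> [a b] st hk hr.
have h1 : st k.+1 = [::] by apply: hr; lia.
have h2 : st k.+2 = [::] by apply: hr; lia.
apply: exec_seq; first (apply: (exec_split _ _ _ hk h1); lia).
apply: exec_to (exec_clear _ _) _.
by store_eq; rewrite h2.
Qed.

(** No computability is asked of [N]: it is just the number of turns that the loop makes. Unbounded
    search enters here. *)
Lemma cmp_while (c : B -> bool) (f : B -> B) (g : A -> B) (N : A -> nat) :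
  cmp c -> cmp f -> cmp g ->
  (forall a, c (iter (N a) f (g a)) = false) ->
  (forall a j, j < N a -> c (iter j f (g a))) ->
  cmp (fun a => iter (N a) f (g a)).
Proof.
move=> hc hf hg cN cj k; have [p hp] := hf k; have [q hq] := hg k.
have [t ht] := cmp_copy hc (leqnn k.+1).
(* The code of a boolean is never empty, whereas [While] tests emptiness: [T] turns it into a flag
   that is empty exactly when [c] fails. *)
pose T := Seq t
  (Case k.+1 Skip Skip (Push k.+1 true)).
have hT b st : st k = encode b -> (forall r, k < r -> st r = [::]) ->
    exec T st (upd st k.+1 (nseq (c b) true)).
  move=> hk hr; apply: (@exec_seq _ _ _ (upd st k.+1 [:: c b])).
    exact: (ht b).
  apply: exec_case_cons; first by rewrite /upd eqxx.
  case: (c b).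
    by apply: exec_to (exec_push _ _ _) _; store_eq.
  by apply: exec_to (exec_skip _) _; store_eq.
exists (Seq q (Seq T (While k.+1 (Seq (Case k.+1 Skip Skip Skip) (Seq p T))))).
move=> a st hk hr; apply: exec_seq; first exact: (hq a).
pose st1 : store := upd st k (@encode B eB (g a)).
have h : exec (Seq T (While k.+1 (Seq (Case k.+1 Skip Skip Skip) (Seq p T)))) st1
    (upd st1 k (encode (iter (N a) f (g a)))); last first.
  by apply: exec_to; [exact: h|rewrite /st1; store_eq].
have {}hk : st1 k = encode (g a) by rewrite /st1; upd_at.
have {}hr r : k < r -> st1 r = [::] by move=> ?; rewrite /st1; upd_at; exact: hr.
clearbody st1; clear st; rename st1 into st.
move: (g a) (N a) (cN a) (cj a) hk => b n cn cl hk.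
apply: exec_seq; first exact: (hT b).
have h1 : st k.+1 = [::] by apply: hr; lia.
elim: n b st hk hr h1 cn cl => [|n IH] b st hk hr h1 /= cn cl.
  rewrite cn; apply: exec_to; first apply: exec_while_nil; first by rewrite /upd eqxx.
  by store_eq.
have /= cb := cl 0 isT; rewrite cb.
apply: exec_while_cons; first by rewrite /upd eqxx.
  apply: exec_seq; first apply: exec_case_cons; first by rewrite /upd eqxx.
    exact: exec_skip.
  have -> : upd (upd st k.+1 [:: true]) k.+1 [::] = st by store_eq.
  apply: exec_seq; first exact: (hp b).
  apply: (hT (f b)); first by rewrite /upd eqxx.
  by move=> r jr; upd_at; rewrite hr //; lia.
apply: exec_to; first apply: IH.
- by upd_at.
- by move=> r jr; upd_at; rewrite hr //; lia.
- by upd_at.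
- by rewrite -iterSr.
- by move=> j jn; rewrite -iterSr; apply: cl.
by rewrite -iterSr; store_eq.
Qed.

End Closure.

Section Basic.
Context {A B C D : Type} {eA : enc A} {eB : enc B} {eC : enc C} {eD : enc D}.

Lemma cmp_id : cmp (fun a : A => a). Proof. exact: cmp_code. Qed.

Lemma cmp_fst (f : A -> B * C) : cmp f -> cmp (fun a => (f a).1).
Proof. exact/cmp_comp/cmp_fst0. Qed.

Lemma cmp_snd (f : A -> B * C) : cmp f -> cmp (fun a => (f a).2).
Proof. exact/cmp_comp/cmp_snd0. Qed.

Lemma cmp_recode (f : A -> B) (g : A -> C) :
  (forall a, encode (f a) = encode (g a)) -> cmp g -> cmp f.
Proof.
move=> fg hg k; have [p hp] := hg k; exists p => a st hk hr.
by rewrite fg; apply: hp.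
Qed.

Lemma cmp_some (f : A -> B) : cmp f -> cmp (fun a => Some (f a)).
Proof.
move=> hf; apply: (cmp_comp _ hf) => k; exists (Push k true) => a st hk _.
by apply: exec_to (exec_push _ _ _) _; store_eq; rewrite hk.
Qed.

End Basic.

Section Cases.
Context {A B C D : Type} {eA : enc A} {eB : enc B} {eC : enc C} {eD : enc D}.

Lemma cmp_succ (f : A -> nat) : cmp f -> cmp (fun a => (f a).+1).
Proof. by move=> hf; apply: cmp_recode (cmp_some hf). Qed.

Lemma cmp_natcase (n : A -> nat) (g : A -> B) (h : A -> nat -> B) :
  cmp n -> cmp g -> cmp (fun p : nat * A => h p.2 p.1) ->
  cmp (fun a => if n a is m.+1 then h a m else g a).
Proof.
move=> hn hg hh.
apply: (@cmp_ext _ _ _ _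
  (fun a => if (if n a is m.+1 then Some m else None) is Some m then h a m else g a)).
  by move=> a; case: (n a).
by apply: cmp_option => //; apply: cmp_recode hn => a; case: (n a).
Qed.

Lemma cmp_cons (x : A -> B) (s : A -> seq B) : cmp x -> cmp s ->
  cmp (fun a => x a :: s a).
Proof. by move=> hx hs; apply: cmp_recode (cmp_pair hx hs). Qed.

Lemma encode_cons_nonnil (x : B) s : encode (x :: s) <> [::].
Proof. by rewrite /=; case: (encode x). Qed.

Lemma cmp_seqcase (s : A -> seq B) (g : A -> C) (h : A -> B -> seq B -> C) :
  cmp s -> cmp g -> cmp (fun p : B * seq B * A => h p.2 p.1.1 p.1.2) ->
  cmp (fun a => if s a is x :: s' then h a x s' else g a).
Proof.
move=> hs hg hh.
pose uncons (s : seq B) := if s is x :: s' then Some (x, s') else None.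
apply: (@cmp_ext _ _ _ _
  (fun a => if uncons (s a) is Some p then h a p.1 p.2 else g a)).
  by move=> a; case: (s a).
apply: (@cmp_option A (B * seq B) C _ _ _ (fun a => uncons (s a)) _
  (fun a p => h a p.1 p.2)) => //; apply: (cmp_comp _ hs) => k.
(* A list is empty exactly when its code is. A nonempty code is already that of the pair of head and
   tail, so only the tag [true] of [Some] is added, after putting back the bit popped by the
   test. *)
exists (Case k Skip (Seq (Push k false) (Push k true)) (Seq (Push k true) (Push k true))).
move=> [|x s'] st hk _.
  apply: exec_case_nil => //; apply: exec_to (exec_skip _) _; store_eq.
case E: (@encode _ (enc_seq eB) (x :: s')) => [|b z]; first by case: (@encode_cons_nonnil x s').
apply: (@exec_case_cons _ _ _ _ _ _ b z); first by rewrite hk.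
have -> : (if b then Seq (Push k true) (Push k true)
           else Seq (Push k false) (Push k true)) =
          Seq (Push k b) (Push k true) by case: (b).
apply: exec_seq (exec_push _ _ _) _; apply: exec_to (exec_push _ _ _) _.
have -> : encode (uncons (x :: s')) = true :: b :: z by rewrite -E.
by store_eq.
Qed.

Lemma cmp_not (c : A -> bool) : cmp c -> cmp (fun a => ~~ c a).
Proof.
move=> hc; apply: (@cmp_ext _ _ _ _ (fun a => if c a then false else true)).
  by move=> a; case: (c a).
by apply: cmp_if => //; apply: cmp_const.
Qed.

Lemma cmp_and (c d : A -> bool) : cmp c -> cmp d -> cmp (fun a => c a && d a).
Proof. by move=> hc hd; apply: cmp_if => //; apply: cmp_const. Qed.

Lemma cmp_natb (c : A -> bool) : cmp c -> cmp (fun a => c a : nat).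
Proof.
move=> hc; apply: (@cmp_ext _ _ _ _ (fun a => if c a then 1 else 0)).
  by move=> a; case: (c a).
by apply: cmp_if => //; apply: cmp_const.
Qed.

End Cases.

(* By eta, [cmp_pair] would apply to any function into a product, forever. *)
Ltac cmp_base :=
  first [ eassumption | apply: cmp_const | apply: cmp_id
        | apply: cmp_fst | apply: cmp_snd
        | lazymatch goal with |- cmp (fun x => (_, _)) => apply: cmp_pair end
        | apply: cmp_succ | apply: cmp_some | apply: cmp_cons
        | apply: cmp_not | apply: cmp_and | apply: cmp_natb ].
Ltac cmp_more := fail.
Ltac cmp_auto := repeat first [cmp_base | cmp_more].

Lemma cmp_iter A B (eA : enc A) (eB : enc B) (n : A -> nat) (f : A -> B -> B) (g : A -> B) :
  cmp n -> cmp g -> cmp (fun p : A * B => f p.1 p.2) ->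
  cmp (fun a => iter (n a) (f a) (g a)).
Proof.
move=> hn hg hf.
pose F (x : nat * (A * B)) := (x.1.-1, (x.2.1, f x.2.1 x.2.2)).
have E m a y j : iter j F (m, (a, y)) = (m - j, (a, iter j (f a) y)).
  elim: j => [|j IH] /=; first by rewrite subn0.
  by rewrite IH /F /= subnS.
apply: (@cmp_ext _ _ _ _
  (fun a => (iter (n a, (a, g a)).1 F (n a, (a, g a))).2.2)).
  by move=> a; rewrite E.
pose G (x : nat * (A * B)) := iter x.1 F x.
have hG : cmp G; last first.
  have h : cmp (fun a => G (n a, (a, g a))) by apply: (cmp_comp hG); cmp_auto.
  by do 2!apply: cmp_snd.
apply: (@cmp_while _ _ _ _ (fun x : nat * (A * B) => ~~ (if x.1 is _.+1 then false else true))).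
- by apply: cmp_not; apply: (@cmp_natcase _ _ _ _ _ _ (fun _ _ => false)); cmp_auto.
- apply: cmp_pair; last apply: cmp_pair; cmp_auto.
    apply: (@cmp_ext _ _ _ _ (fun x : nat * (A * B) => if x.1 is m.+1 then m else 0)).
      by move=> [[]].
    by apply: (@cmp_natcase _ _ _ _ _ _ (fun _ m => m)); cmp_auto.
  by apply: (cmp_comp (f := snd) hf); cmp_auto.
- exact: cmp_id.
- by move=> [m [a y]]; rewrite E /= subnn.
- by move=> [m [a y]] j /= jm; rewrite E /=; case: (m - j) (subn_gt0 j m) => //; rewrite jm.
Qed.

(** [F] is characterised by recursion equations, so that the lemma applies to library functions
    whatever their definition. *)
Lemma cmp_natrec A B (eA : enc A) (eB : enc B) (n : A -> nat) (F : A -> nat -> B) (g : A -> B)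
    (h : A -> nat -> B -> B) :
  cmp n -> cmp g -> cmp (fun p : A * (nat * B) => h p.1 p.2.1 p.2.2) ->
  (forall a, F a 0 = g a) -> (forall a m, F a m.+1 = h a m (F a m)) ->
  cmp (fun a => F a (n a)).
Proof.
move=> hn hg hh F0 FS.
pose step a (p : nat * B) := (p.1.+1, h a p.1 p.2).
apply: (@cmp_ext _ _ _ _ (fun a => (iter (n a) (step a) (0, g a)).2)).
  move=> a; suff -> : iter (n a) (step a) (0, g a) = (n a, F a (n a)) by [].
  by elim: (n a) => [|m IH] /=; rewrite ?F0 // IH FS.
by apply: cmp_snd; apply: cmp_iter; rewrite /step; cmp_auto.
Qed.

Lemma cmp_search A (eA : enc A) (Q : A -> nat -> bool) (mu : A -> nat) :
  cmp (fun p : A * nat => Q p.1 p.2) ->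
  (forall a, Q a (mu a)) -> (forall a m, m < mu a -> ~~ Q a m) -> cmp mu.
Proof.
move=> hQ h1 h2.
pose F (x : A * nat) := (x.1, x.2.+1).
have E a j : iter j F (a, 0) = (a, j).
  by elim: j => [|j IH] //=; rewrite IH.
apply: (@cmp_ext _ _ _ _ (fun a => (iter (mu a) F (a, 0)).2)).
  by move=> a; rewrite E.
apply: cmp_snd; apply: (@cmp_while _ _ _ _ (fun x => ~~ Q x.1 x.2)); rewrite /F.
- exact: cmp_not.
- by cmp_auto.
- by cmp_auto.
- by move=> a; rewrite E h1.
- by move=> a j ja; rewrite E h2.
Qed.

Lemma cmp_foldl A B X (eA : enc A) (eB : enc B) (eX : enc X)
    (f : A -> B -> X -> B) (z : A -> B) (s : A -> seq X) :
  cmp z -> cmp s -> cmp (fun p : A * (B * X) => f p.1 p.2.1 p.2.2) ->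
  cmp (fun a => foldl (f a) (z a) (s a)).
Proof.
move=> hz hs hf.
pose F (x : seq X * (A * B)) :=
  if x.1 is u :: s' then (s', (x.2.1, f x.2.1 x.2.2 u)) else x.
have E a y (t : seq X) j : iter j F (t, (a, y)) = (drop j t, (a, foldl (f a) y (take j t))).
  elim: j t y => [|j IH] [|u t] y //; first by rewrite iterSr IH.
  by rewrite iterSr /F /= IH.
apply: (@cmp_ext _ _ _ _ (fun a => (iter (size (s a)) F (s a, (a, z a))).2.2)).
  by move=> a; rewrite E take_size.
do 2!apply: cmp_snd.
apply: (@cmp_while _ _ _ _ (fun x : seq X * (A * B) => if x.1 is _ :: _ then true else false)).
- by apply: (@cmp_seqcase _ _ _ _ _ _ _ _ (fun _ _ _ => true)); cmp_auto.
- apply: (@cmp_seqcase _ _ _ _ _ _ _ _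
    (fun (x : seq X * (A * B)) u s' => (s', (x.2.1, f x.2.1 x.2.2 u)))); cmp_auto.
  apply: (cmp_comp (f := fun p : X * seq X * (seq X * (A * B)) =>
    (p.2.2.1, (p.2.2.2, p.1.1))) hf); cmp_auto.
- by cmp_auto.
- by move=> a; rewrite E drop_size.
- move=> a j js; rewrite E; case: (drop j (s a)) (size_drop j (s a)) => //= /eqP.
  by rewrite eq_sym subn_eq0 leqNgt js.
Qed.

Lemma cmp_rev A X (eA : enc A) (eX : enc X) (s : A -> seq X) :
  cmp s -> cmp (fun a => rev (s a)).
Proof.
move=> hs.
apply: (@cmp_ext _ _ _ _ (fun a => foldl (fun t x => x :: t) [::] (s a))).
  by move=> a; rewrite /rev; elim: (s a) [::] => //= x t IH acc; exact: IH.
by apply: cmp_foldl; cmp_auto.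
Qed.

Lemma cmp_foldr A B X (eA : enc A) (eB : enc B) (eX : enc X)
    (f : A -> X -> B -> B) (z : A -> B) (s : A -> seq X) :
  cmp z -> cmp s -> cmp (fun p : A * (B * X) => f p.1 p.2.2 p.2.1) ->
  cmp (fun a => foldr (f a) (z a) (s a)).
Proof.
move=> hz hs hf.
apply: (@cmp_ext _ _ _ _ (fun a => foldl (fun y x => f a x y) (z a) (rev (s a)))).
  by move=> a; rewrite foldl_rev.
by apply: cmp_foldl => //; apply: cmp_rev.
Qed.

Lemma cmp_cat A X (eA : enc A) (eX : enc X) (s t : A -> seq X) :
  cmp s -> cmp t -> cmp (fun a => s a ++ t a).
Proof.
move=> hs ht; apply: (@cmp_ext _ _ _ _ (fun a => foldr cons (t a) (s a))).
  by move=> a; elim: (s a) => //= x u ->.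
by apply: cmp_foldr; cmp_auto.
Qed.

Lemma cmp_map A X Y (eA : enc A) (eX : enc X) (eY : enc Y)
    (f : A -> X -> Y) (s : A -> seq X) :
  cmp s -> cmp (fun p : A * X => f p.1 p.2) -> cmp (fun a => map (f a) (s a)).
Proof.
move=> hs hf; apply: (cmp_foldr (f := fun a x y => f a x :: y)) => //; cmp_auto.
by apply: (cmp_comp (f := fun p : A * (seq Y * X) => (p.1, p.2.2)) hf); cmp_auto.
Qed.

Lemma cmp_size A X (eA : enc A) (eX : enc X) (s : A -> seq X) :
  cmp s -> cmp (fun a => size (s a)).
Proof. by move=> hs; apply: (cmp_foldr (f := fun _ _ => succn)); cmp_auto. Qed.

Lemma cmp_head A X (eA : enc A) (eX : enc X) (x0 : X) (s : A -> seq X) :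
  cmp s -> cmp (fun a => head x0 (s a)).
Proof.
by move=> hs; apply: (@cmp_seqcase _ _ _ _ _ _ _ _ (fun _ x _ => x)); cmp_auto.
Qed.

Lemma cmp_behead A X (eA : enc A) (eX : enc X) (s : A -> seq X) :
  cmp s -> cmp (fun a => behead (s a)).
Proof.
by move=> hs; apply: (@cmp_seqcase _ _ _ _ _ _ _ _ (fun _ _ s' => s')); cmp_auto.
Qed.

Lemma cmp_nth A X (eA : enc A) (eX : enc X) (x0 : X) (s : A -> seq X) j :
  cmp s -> cmp (fun a => nth x0 (s a) j).
Proof.
elim: j s => [|j IH] s hs.
  by apply: cmp_ext (cmp_head x0 hs) => a; rewrite nth0.
by apply: cmp_ext (IH _ (cmp_behead hs)) => a; rewrite nth_behead.
Qed.

Lemma cmp_raw_cons : cmp (fun p : bool * raw => Raw (p.1 :: unraw p.2)).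
Proof.
move=> k.
pose P b := Case k Skip (Push k b) (Push k b).
(* The code of [(b, x)] is [true :: b :: false :: unraw x]: the two delimiters are dropped and [b]
   is put back. *)
exists (Case k Skip Skip (Case k Skip (P false) (P true))) => -[b x] st hk _.
apply: exec_case_cons; first exact: hk.
apply: (@exec_case_cons _ _ _ _ _ _ b (false :: unraw x)); first by upd_at.
have -> : (if b then P true else P false) = P b by case: (b).
apply: (@exec_case_cons _ _ _ _ _ _ false (unraw x)); first by upd_at.
by apply: exec_to (exec_push _ _ _) _; store_eq.
Qed.

(** As an element of [seq bool], each bit occupies three bits of the code; this translates to the
    verbatim form used for input and output. *)
Lemma cmp_Raw A (eA : enc A) (s : A -> seq bool) :
  cmp s -> cmp (fun a => Raw (s a)).
Proof.
move=> hs; apply: (@cmp_ext _ _ _ _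
  (fun a => foldr (fun b x => Raw (b :: unraw x)) (Raw [::]) (s a))).
  by move=> a; elim: (s a) => //= b x ->.
apply: cmp_foldr; cmp_auto.
apply: (cmp_comp (f := fun p : A * (raw * bool) => (p.2.2, p.2.1)) cmp_raw_cons).
by cmp_auto.
Qed.

Definition raw_uncons (x : raw) : option (bool * raw) :=
  if unraw x is b :: y then Some (b, Raw y) else None.

Lemma cmp_raw_uncons : cmp raw_uncons.
Proof.
move=> k.
(* The code of [Some (b, Raw y)] is [true :: true :: b :: false :: y], pushed from its right end. *)
pose P b := Seq (Push k false) (Seq (Push k b) (Seq (Push k true) (Push k true))).
exists (Case k Skip (P false) (P true)) => -[[|b x]] st hk _.
  by apply: exec_case_nil => //; apply: exec_to (exec_skip _) _; store_eq.
apply: exec_case_cons; first exact: hk.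
have -> : (if b then P true else P false) = P b by case: (b).
do 3!apply: exec_seq (exec_push _ _ _) _.
by apply: exec_to (exec_push _ _ _) _; store_eq.
Qed.

Lemma cmp_unraw A (eA : enc A) (x : A -> raw) :
  cmp x -> cmp (fun a => unraw (x a)).
Proof.
move=> hx.
pose F (p : raw * seq bool) :=
  if raw_uncons p.1 is Some q then (q.2, q.1 :: p.2) else p.
have E y t j : iter j F (Raw y, t) = (Raw (drop j y), catrev (take j y) t).
  elim: j y t => [|j IH] [|u y] t //; first by rewrite iterSr IH.
  by rewrite iterSr /F /= IH.
apply: (@cmp_ext _ _ _ _
  (fun a => rev (iter (size (unraw (x a))) F (x a, [::])).2)).
  by move=> a; case: (x a) => y /=; rewrite E take_size catrevE cats0 revK.
apply: cmp_rev; apply: cmp_snd.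
apply: (@cmp_while _ _ _ _
  (fun p : raw * seq bool => if raw_uncons p.1 is Some _ then true else false)).
- apply: (@cmp_option _ _ _ _ _ _ _ _ (fun _ _ => true)); cmp_auto.
  by apply: (cmp_comp cmp_raw_uncons); cmp_auto.
- apply: (@cmp_option _ _ _ _ _ _ _ _
    (fun (p : raw * seq bool) q => (q.2, q.1 :: p.2))); cmp_auto.
  by apply: (cmp_comp cmp_raw_uncons); cmp_auto.
- by cmp_auto.
- by move=> a; case: (x a) => y /=; rewrite E drop_size.
- move=> a j; case: (x a) => y /= js; rewrite E /raw_uncons /=.
  by rewrite (drop_nth true).
Qed.

(* Maps to a finite type are computed by cases, without encoding their values. *)
Definition cmp_fin A {eA : enc A} (F : finType) (u : A -> F) : Prop :=
  forall x, cmp (fun a => u a == x).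

Lemma cmp_fincase A B (eA : enc A) (eB : enc B) (F : finType) (u : A -> F)
    (h : F -> A -> B) :
  cmp_fin u -> (forall x, cmp (h x)) -> cmp (fun a => h (u a) a).
Proof.
move=> hu hh; case: (pickP F) => [x0 _|F0]; last first.
  (* If [F] is empty then so is [A], because of [u]. *)
  by move=> k; exists Skip => a; have := F0 (u a).
pose H s a := foldr (fun x y => if u a == x then h x a else y) (h x0 a) s.
apply: (@cmp_ext _ _ _ _ (H (enum F))).
  move=> a; have : u a \in enum F by rewrite mem_enum.
  rewrite /H; elim: (enum F) => //= x s IH; rewrite inE; case: eqP => [->|_] //=.
rewrite /H; elim: (enum F) => [|x s IH] /=; first exact: hh.
by apply: cmp_if => //; exact: hu.
Qed.

Lemma cmp_fin_pair A (eA : enc A) (F G : finType) (u : A -> F) (v : A -> G) :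
  cmp_fin u -> cmp_fin v -> cmp_fin (fun a => (u a, v a)).
Proof. by move=> hu hv [x y]; apply: cmp_and. Qed.

Lemma cmp_fin_ffun A (eA : enc A) (I F : finType) (u : I -> A -> F) :
  (forall i, cmp_fin (u i)) -> cmp_fin (fun a => [ffun i => u i a]).
Proof.
move=> hu x; apply: (@cmp_ext _ _ _ _
  (fun a => all (fun i => u i a == x i) (enum I))).
  move=> a; apply/allP/eqP => [h|<- i _]; last by rewrite ffunE.
  by apply/ffunP => i; rewrite ffunE; apply/eqP/h; rewrite mem_enum.
elim: (enum I) => [|i s IH] /=; first exact: cmp_const.
by apply: cmp_and => //; exact: hu.
Qed.

Definition enc_fin (F : finType) : enc F :=
  Enc (fun x => encode (enum_rank x : nat)).

Lemma cmp_eq_const A (eA : enc A) (n : A -> nat) m :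
  cmp n -> cmp (fun a => n a == m).
Proof.
elim: m A eA n => [|m IH] A eA n hn.
  apply: (@cmp_ext _ _ _ _ (fun a => if n a is _.+1 then false else true)).
    by move=> a; case: (n a).
  by apply: (@cmp_natcase _ _ _ _ _ _ (fun _ _ => false)); cmp_auto.
apply: (@cmp_ext _ _ _ _ (fun a => if n a is k.+1 then k == m else false)).
  by move=> a; case: (n a).
by apply: (@cmp_natcase _ _ _ _ _ _ (fun _ k => k == m)); cmp_auto; apply: IH; cmp_auto.
Qed.

Lemma cmp_fin_enc A (eA : enc A) (F : finType) (u : A -> F) :
  @cmp _ _ _ (enc_fin F) u -> cmp_fin u.
Proof.
move=> hu x; apply: (@cmp_ext _ _ _ _ (fun a => enum_rank (u a) == enum_rank x :> nat)).
  by move=> a; rewrite (inj_eq val_inj) (inj_eq enum_rank_inj).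
by apply: cmp_eq_const; apply: cmp_recode hu.
Qed.

#[export] Instance enc_ffun (I : finType) B (eB : enc B) : enc {ffun I -> B} :=
  Enc (fun phi : {ffun I -> B} => encode [seq phi i | i <- enum I]).

Lemma cmp_ffun_get A B (eA : enc A) (eB : enc B) (b0 : B) (I : finType)
    (phi : A -> {ffun I -> B}) i :
  cmp phi -> cmp (fun a => phi a i).
Proof.
move=> hphi; apply: (@cmp_ext _ _ _ _
  (fun a => nth b0 [seq phi a j | j <- enum I] (enum_rank i))).
  move=> a; rewrite (nth_map i); last by rewrite -cardE.
  by rewrite nth_enum_rank.
by apply: cmp_nth; apply: cmp_recode hphi.
Qed.

Lemma cmp_ffun A B (eA : enc A) (eB : enc B) (I : finType) (g : I -> A -> B) :
  (forall i, cmp (g i)) -> cmp (fun a => [ffun i => g i a]).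
Proof.
move=> hg; apply: (@cmp_recode _ _ _ _ _ _ _ (fun a => [seq g i a | i <- enum I])).
  by move=> a; congr (encode_seq _ _); apply: eq_map => i; rewrite ffunE.
elim: (enum I) => [|i s IH] /=; first exact: cmp_const.
by apply: cmp_cons => //; exact: hg.
Qed.

Ltac cmp_more ::=
  lazymatch goal with
  | |- cmp (fun x => _ ++ _) => apply: cmp_cat
  | |- cmp (fun x => rev _) => apply: cmp_rev
  | |- cmp (fun x => size _) => apply: cmp_size
  | |- cmp (fun x => head _ _) => apply: cmp_head
  | |- cmp (fun x => behead _) => apply: cmp_behead
  | |- cmp (fun x => Raw _) => apply: cmp_Raw
  | |- cmp (fun x => unraw _) => apply: cmp_unraw
  | |- cmp unraw => apply: cmp_unraw
  end.

(** * Simulation of Turing machines, arithmetic *)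

Section Simulation.
Variable M : TM.

Local Notation letter := (cell (alphabet M)).
Local Instance enc_letter : enc letter := enc_fin _.
Local Instance enc_state : enc (state M) := enc_fin _.
#[export] Instance enc_tape : enc (tape (alphabet M)) := enc_prod _ _.
#[export] Instance enc_config : enc (config M) := enc_prod _ _.

(** The state and the scanned cells take finitely many values; once they are fixed, the transition
    is a constant and each tape undergoes fixed list operations. *)
Lemma cmp_step : cmp (@step M).
Proof.
pose h (x : state M * {ffun 'I_(ntapes M).+1 -> letter}) (c : config M) :=
  omap (fun qa : state M * {ffun 'I_(ntapes M).+1 -> letter * move} =>
    (qa.1, [ffun i => write_move (c.2 i) (qa.2 i)])) (trans x.1 x.2).
pose u (c : config M) := (c.1, [ffun i => read (c.2 i)]).
apply: (@cmp_fincase _ _ _ _ _ u h).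
  apply: cmp_fin_pair; first by apply: cmp_fin_enc; exact: cmp_fst0.
  apply: cmp_fin_ffun => i; apply: cmp_fin_enc; apply: cmp_head; apply: cmp_snd.
  by apply: (cmp_ffun_get ([::], [::])); exact: cmp_snd0.
move=> x; rewrite /h; case: trans => [[q a]|] /=; last exact: cmp_const.
apply: cmp_some; apply: cmp_pair; first exact: cmp_const.
apply: cmp_ffun => i; case: (a i) => x' m.
have ht : cmp (fun c : config M => c.2 i).
  by apply: (cmp_ffun_get ([::], [::])); exact: cmp_snd0.
rewrite /write_move; case: m => /=.
- by apply: (@cmp_pair _ (seq letter) (seq letter)); cmp_auto.
- by apply: (@cmp_pair _ (seq letter) (seq letter)); cmp_auto.
- by apply: (@cmp_pair _ (seq letter) (seq letter)); cmp_auto.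
Qed.

Lemma cmp_run A (eA : enc A) (n : A -> nat) (c : A -> config M) :
  cmp n -> cmp c -> cmp (fun a => run (n a) (c a)).
Proof.
move=> hn hc; apply: (cmp_iter (f := fun _ c => odflt c (step c))) => //.
apply: (@cmp_option _ _ _ _ _ _ _ _ (fun _ c' => c')); cmp_auto.
by apply: (cmp_comp cmp_step); cmp_auto.
Qed.

Definition halted (c : config M) : bool := if step c is Some _ then false else true.

Lemma haltedP c : reflect (step c = None) (halted c).
Proof. by rewrite /halted; case: step => [?|]; constructor. Qed.

Lemma cmp_halted A (eA : enc A) (c : A -> config M) :
  cmp c -> cmp (fun a => halted (c a)).
Proof.
move=> hc; apply: (@cmp_option _ _ _ _ _ _ _ _ (fun _ _ => false)); cmp_auto.
exact: (cmp_comp cmp_step).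
Qed.

Lemma cmp_init A (eA : enc A) (x : A -> string) :
  cmp x -> cmp (fun a => init M (x a)).
Proof.
move=> hx; apply: cmp_pair; first exact: cmp_const.
apply: cmp_ffun => i; case: (i == ord0); last exact: cmp_const.
apply: cmp_pair; first exact: cmp_const.
apply: (cmp_map (f := fun _ b => Some (inl b) : letter)) => //.
apply: (@cmp_ext _ _ _ _
  (fun p : A * bool => if p.2 then Some (inl true) : letter else Some (inl false))).
  by case=> a [].
by apply: cmp_if; cmp_auto.
Qed.

Lemma cmp_output A (eA : enc A) (c : A -> config M) :
  cmp c -> cmp (fun a => output (c a)).
Proof.
move=> hc; pose f (x : letter) (y : string) :=
  if x == Some (inl true) then true :: y else
  if x == Some (inl false) then false :: y else [::].
apply: (@cmp_ext _ _ _ _ (fun a => foldr f [::] ((c a).2 ord0).2)).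
  move=> a; rewrite /output; elim: (_.2) => //= x s ->.
  by rewrite /f; case: x => [[[]|x]|].
apply: (cmp_foldr (f := fun _ => f)); first exact: cmp_const.
  by apply: cmp_snd; apply: (cmp_ffun_get ([::], [::])); cmp_auto.
have hx b : cmp (fun p : A * (string * letter) => p.2.2 == Some (inl b)).
  by apply: (@cmp_fin_enc _ _ _ (fun p : A * (string * letter) => p.2.2)); cmp_auto.
by rewrite /f; apply: cmp_if; [|cmp_auto|apply: cmp_if; cmp_auto].
Qed.

End Simulation.

Section Arithmetic.
Context {A : Type} {eA : enc A}.
Implicit Types m n d : A -> nat.

Lemma cmp_pred n : cmp n -> cmp (fun a => (n a).-1).
Proof.
move=> hn; apply: (@cmp_ext _ _ _ _ (fun a => if n a is k.+1 then k else 0)).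
  by move=> a; case: (n a).
by apply: (@cmp_natcase _ _ _ _ _ _ (fun _ k => k)); cmp_auto.
Qed.

Lemma cmp_add m n : cmp m -> cmp n -> cmp (fun a => m a + n a).
Proof.
move=> hm hn; apply: (cmp_natrec (F := fun a k => m a + k)
  (h := fun _ _ y => y.+1) hn hm).
- by cmp_auto.
- by move=> a; rewrite addn0.
- by move=> a k; rewrite addnS.
Qed.

End Arithmetic.

Section Arithmetic.
Context {A : Type} {eA : enc A}.
Implicit Types m n d : A -> nat.

Lemma cmp_mul m n : cmp m -> cmp n -> cmp (fun a => m a * n a).
Proof.
move=> hm hn; apply: (cmp_natrec (F := fun a k => m a * k)
  (g := fun=> 0) (h := fun a _ y => m a + y) hn).
- exact: cmp_const.
- by apply: cmp_add; [apply: cmp_comp hm _|]; cmp_auto.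
- by move=> a; rewrite muln0.
- by move=> a k; rewrite mulnS.
Qed.

Lemma cmp_sub m n : cmp m -> cmp n -> cmp (fun a => m a - n a).
Proof.
move=> hm hn; apply: (cmp_natrec (F := fun a k => m a - k)
  (h := fun _ _ y => y.-1) hn hm).
- by apply: cmp_pred; cmp_auto.
- by move=> a; rewrite subn0.
- by move=> a k; rewrite subnS.
Qed.

Lemma cmp_leq m n : cmp m -> cmp n -> cmp (fun a => m a <= n a).
Proof. by move=> hm hn; apply: cmp_eq_const; apply: cmp_sub. Qed.

Lemma cmp_half_odd n : cmp n -> cmp (fun a => ((n a)./2, odd (n a))).
Proof.
move=> hn; apply: (cmp_natrec (F := fun _ k => (k./2, odd k)) (g := fun=> (0, false))
  (h := fun _ _ y => if y.2 then (y.1.+1, false) else (y.1, true)) hn) => //.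
- exact: cmp_const.
- by apply: cmp_if; cmp_auto.
- by move=> _ k; rewrite /= uphalf_half; case: (odd k).
Qed.

End Arithmetic.

Section Arithmetic.
Context {A : Type} {eA : enc A}.
Implicit Types m n d : A -> nat.

Lemma cmp_exp m n : cmp m -> cmp n -> cmp (fun a => m a ^ n a).
Proof.
move=> hm hn; apply: (cmp_natrec (F := fun a k => m a ^ k)
  (g := fun=> 1) (h := fun a _ y => m a * y) hn) => //.
- exact: cmp_const.
- by apply: cmp_mul; [apply: cmp_comp hm _|]; cmp_auto.
- by move=> a k; rewrite expnS.
Qed.

Lemma cmp_eqn m n : cmp m -> cmp n -> cmp (fun a => m a == n a).
Proof.
move=> hm hn; apply: (@cmp_ext _ _ _ _ (fun a => (m a <= n a) && (n a <= m a))).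
  by move=> a; rewrite eqn_leq.
by apply: cmp_and; apply: cmp_leq.
Qed.

Lemma cmp_half n : cmp n -> cmp (fun a => (n a)./2).
Proof. by move=> hn; exact: (cmp_fst (cmp_half_odd hn)). Qed.

Lemma cmp_odd n : cmp n -> cmp (fun a => odd (n a)).
Proof. by move=> hn; exact: (cmp_snd (cmp_half_odd hn)). Qed.

Lemma cmp_sum n (F : A -> nat -> nat) : cmp n ->
  cmp (fun p : A * nat => F p.1 p.2) -> cmp (fun a => \sum_(0 <= i < n a) F a i).
Proof.
move=> hn hF; apply: (cmp_natrec (F := fun a k => \sum_(0 <= i < k) F a i)
  (g := fun=> 0) (h := fun a k y => y + F a k) hn).
- exact: cmp_const.
- apply: cmp_add; cmp_auto.
  by apply: (cmp_comp (f := fun p : A * (nat * nat) => (p.1, p.2.1)) hF); cmp_auto.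
- by move=> a; rewrite big_geq.
- by move=> a k; rewrite big_nat_recr.
Qed.

Lemma cmp_has n (P : A -> nat -> bool) : cmp n ->
  cmp (fun p : A * nat => P p.1 p.2) -> cmp (fun a => has (P a) (iota 0 (n a))).
Proof.
move=> hn hP; apply: (cmp_natrec (F := fun a k => has (P a) (iota 0 k))
  (g := fun=> false) (h := fun a k y => if y then true else P a k) hn) => //.
- exact: cmp_const.
- apply: cmp_if; cmp_auto.
  by apply: (cmp_comp (f := fun p : A * (nat * bool) => (p.1, p.2.1)) hP); cmp_auto.
- by move=> a k; rewrite -addn1 iotaD has_cat /= orbF.
Qed.

Lemma cmp_all n (P : A -> nat -> bool) : cmp n ->
  cmp (fun p : A * nat => P p.1 p.2) -> cmp (fun a => all (P a) (iota 0 (n a))).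
Proof.
move=> hn hP; apply: (@cmp_ext _ _ _ _
  (fun a => ~~ has (fun i => ~~ P a i) (iota 0 (n a)))).
  by move=> a; rewrite has_predC negbK.
by apply: cmp_not; apply: cmp_has => //; apply: cmp_not.
Qed.

End Arithmetic.

Ltac cmp_more ::=
  lazymatch goal with
  | |- cmp (fun x => _ ++ _) => apply: cmp_cat
  | |- cmp (fun x => rev _) => apply: cmp_rev
  | |- cmp (fun x => size _) => apply: cmp_size
  | |- cmp (fun x => head _ _) => apply: cmp_head
  | |- cmp (fun x => behead _) => apply: cmp_behead
  | |- cmp (fun x => Raw _) => apply: cmp_Raw
  | |- cmp (fun x => unraw _) => apply: cmp_unraw
  | |- cmp unraw => apply: cmp_unraw
  | |- cmp (fun x => run _ _) => apply: cmp_run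
  | |- cmp (fun x => halted _) => apply: cmp_halted
  | |- cmp (fun x => init _ _) => apply: cmp_init
  | |- cmp (fun x => output _) => apply: cmp_output
  | |- cmp (fun x => _.-1) => apply: cmp_pred
  | |- cmp (fun x => _ + _) => apply: cmp_add
  | |- cmp (fun x => _ * _) => apply: cmp_mul
  | |- cmp (fun x => _ - _) => apply: cmp_sub
  | |- cmp (fun x => _ ^ _) => apply: cmp_exp
  | |- cmp (fun x => leq _ _) => apply: cmp_leq
  | |- cmp (leq _) => apply: cmp_leq
  | |- cmp (fun x => _ == _ :> nat) => apply: cmp_eqn
  | |- cmp (fun x => _./2) => apply: cmp_half
  | |- cmp (fun x => odd _) => apply: cmp_odd
  end.

(** * Primes and binary notation *)

Section Primes.
Context {A : Type} {eA : enc A}.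
Implicit Types m n d : A -> nat.

Lemma cmp_dvdn d m : cmp d -> cmp m -> cmp (fun a => d a %| m a).
Proof.
move=> hd hm; apply: (@cmp_ext _ _ _ _
  (fun a => has (fun k => k * d a == m a) (iota 0 (m a).+1))).
  move=> a; apply/hasP/idP => [[k _ /eqP <-]|/dvdnP[k mk]]; first exact: dvdn_mull.
  case: (posnP (d a)) => d0.
    by exists 0; [rewrite mem_iota|rewrite mk d0 !muln0].
  by exists k; [rewrite mem_iota /= add0n ltnS mk leq_pmulr|rewrite mk].
apply: cmp_has; cmp_auto.
  by apply: (cmp_comp (f := fst) hd); cmp_auto.
by apply: (cmp_comp (f := fst) hm); cmp_auto.
Qed.

End Primes.

Lemma cmp_prime : cmp prime.
Proof.
apply: (@cmp_ext _ _ _ _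
  (fun p => (1 < p) && ~~ has (fun d => (1 < d) && (d %| p)) (iota 0 p))).
  move=> p; case: (ltnP 1 p) => p1 /=; last by case: p p1 => [|[|]].
  apply/hasPn/idP => [h|pp d].
    apply/primeP; split=> // d dp.
    case: (ltngtP 1 d) => [d1|d1|<-]; rewrite ?orbT //.
      have := dvdn_leq (ltnW p1) dp; rewrite leq_eqVlt => /orP[->|dlp].
        by rewrite orbT.
      by have := h d; rewrite mem_iota add0n dlp dp d1 => /(_ isT).
    by case: d d1 dp => // _; rewrite dvd0n => /eqP p0; rewrite p0 in p1.
  rewrite mem_iota add0n /= => dp; apply/negP => /andP[d1 ddp].
  have /primeP[_ /(_ _ ddp)] := pp; case/orP => /eqP E; first by rewrite E in d1.
  by rewrite E ltnn in dp.
apply: cmp_and; cmp_auto; apply: cmp_has; cmp_auto.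
by apply: cmp_dvdn; cmp_auto.
Qed.

Lemma cmp_next_prime : cmp next_prime.
Proof.
apply: (@cmp_search _ _ (fun n p => (n < p) && prime p)).
- by apply: cmp_and; [|apply: (cmp_comp cmp_prime)]; cmp_auto.
- by move=> n; rewrite /next_prime; case: ex_minnP.
- move=> n m; rewrite /next_prime; case: ex_minnP => p _ hp mp.
  by apply/negP => /hp; rewrite leqNgt mp.
Qed.

Lemma cmp_nth_prime : cmp nth_prime.
Proof.
apply: (cmp_iter (f := fun=> next_prime)); cmp_auto.
by apply: (cmp_comp cmp_next_prime); cmp_auto.
Qed.

(** The initial value 1 restores the leading digit dropped by [bin]. *)
Definition unbin (x : string) : nat := foldl (fun (a : nat) (b : bool) => b + a.*2) 1 x.

Lemma unbin_rcons x b : unbin (rcons x b) = b + (unbin x).*2.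
Proof. by rewrite /unbin -cats1 foldl_cat. Qed.

Lemma bin_rec n : 1 < n -> bin n = rcons (bin n./2) (odd n).
Proof.
move=> n1; rewrite /bin.
have -> : trunc_log 2 n = (trunc_log 2 n./2).+1.
  by rewrite trunc_log2S.
rewrite -[RHS]revK rev_rcons revK -[(trunc_log 2 _).+1]add1n /mkseq iotaD map_cat /=.
rewrite expn0 divn1; congr (rev (_ :: _)).
rewrite -[X in iota X]addn0 iotaDl -map_comp; apply: eq_map => i /=.
by rewrite expnS divnMA divn2.
Qed.

Lemma unbinK n : 0 < n -> unbin (bin n) = n.
Proof.
elim/ltn_ind: n => n IH n0; case: (leqP n 1) => n1.
  by have -> : n = 1 by lia.
by rewrite bin_rec // unbin_rcons IH ?odd_double_half; lia.
Qed.

Lemma unbin_gt0 x : 0 < unbin x.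
Proof. by elim/last_ind: x => // x b IH; rewrite unbin_rcons; lia. Qed.

Lemma binK x : bin (unbin x) = x.
Proof.
elim/last_ind: x => [|x b IH]; first by [].
have := unbin_gt0 x; rewrite unbin_rcons => x0.
by rewrite bin_rec; [rewrite half_bit_double oddD odd_double IH; case: (b)|lia].
Qed.

Lemma unbin_lt x : unbin x < 2 ^ (size x).+1.
Proof.
elim/last_ind: x => // x b IH.
by rewrite unbin_rcons size_rcons expnS; case: b; lia.
Qed.

Lemma cmp_bin : cmp bin.
Proof.
(* [F] moves the last digit to the accumulator and is stationary once the number is at most 1, so
   [n] rounds suffice. *)
pose F (p : nat * string) := if 1 < p.1 then (p.1./2, odd p.1 :: p.2) else p.
have E j n x : n <= j.+1 -> (iter j F (n, x)).2 = bin n ++ x.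
  elim: j n x => [|j IH] n x nj; first by case: n nj => [|[|]].
  rewrite iterSr /F /=; case: (ltnP 1 n) => n1; last first.
    by rewrite IH //; lia.
  rewrite (bin_rec n1) cat_rcons IH; [by []|lia].
apply: (@cmp_ext _ _ _ _ (fun n => (iter n F (n, [::])).2)).
  by move=> n; rewrite E ?cats0.
apply: cmp_snd; apply: (cmp_iter (f := fun=> F)); cmp_auto.
by rewrite /F; apply: cmp_if; cmp_auto.
Qed.

Lemma cmp_unbin A (eA : enc A) (x : A -> string) :
  cmp x -> cmp (fun a => unbin (x a)).
Proof.
move=> hx; apply: (cmp_foldl (f := fun _ (a : nat) (b : bool) => b + a.*2)); cmp_auto.
apply: (@cmp_ext _ _ _ _
  (fun p : A * (nat * bool) => p.2.1 + p.2.1)); last by cmp_auto.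
by move=> p; rewrite addnn.
Qed.

(** * Halting times and incompressibility *)

Lemma computes_run (M : TM) x n :
  halted (run n (init M x)) -> computes M x (output (run n (init M x))).
Proof. by move=> /haltedP h; exists n. Qed.

Lemma run_halted (M : TM) (c : config M) m n :
  halted (run m c) -> m <= n -> run n c = run m c.
Proof.
move=> /haltedP h /subnK <-; rewrite /run iterD.
by elim: (n - m) => //= k ->; rewrite -/(run m c) h.
Qed.

Lemma computesP (M : TM) x y :
  computes M x y <-> exists n, halted (run n (init M x)) /\ output (run n (init M x)) = y.
Proof. by split=> -[n [/haltedP h1 h2]]; exists n; split=> //; apply/haltedP. Qed.

Lemma computes_fun (M : TM) x y z : computes M x y -> computes M x z -> y = z.
Proof.
move=> /computesP[m [hm <-]] /computesP[n [hn <-]].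
case: (leqP m n) => h; first by rewrite (run_halted hm h).
by rewrite (run_halted hn (ltnW h)).
Qed.

(* One computes from [a] a string longer than all outputs of [T] on the inputs
   of length less than [e a]; its complexity is at least [e a] by construction,
   and at most [size (encode a) + c] by universality. *)
Lemma incompressible (T : TM) (A : Type) (eA : enc A) (e k : A -> nat) :
  universal T (fun=> True) -> cmp e -> cmp k ->
  (forall a w, size w < e a -> dom T w -> halted (run (k a) (init T w))) ->
  exists c, forall a, e a <= size (encode a) + c.
Proof.
move=> hT he hk hd.
(* The initial [[:: true]] makes the concatenation strictly longer than each of its pieces.
   Simulations unfinished after [k a] steps contribute arbitrary strings, which can only lengthen
   it. *)
pose F a n := iteri n (fun i y => output (run (k a) (init T (bin i))) ++ y) [:: true].
have FS a n : F a n.+1 = output (run (k a) (init T (bin n))) ++ F a n by [].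
have F0 a n : 0 < size (F a n).
  by elim: n => // n IH; rewrite FS size_cat addn_gt0 IH orbT.
have sF a n i : i < n -> size (output (run (k a) (init T (bin i)))) < size (F a n).
  elim: n => // n IH; rewrite ltnS leq_eqVlt FS size_cat => /orP[/eqP ->|/IH h].
    by rewrite -[X in X < _]addn0 ltn_add2l.
  exact: leq_trans h (leq_addl _ _).
have hF : cmp (fun a => Raw (F a (2 ^ e a))).
  apply: cmp_Raw; apply: (cmp_natrec (g := fun=> [:: true])
    (h := fun a i y => output (run (k a) (init T (bin i))) ++ y)) => //.
  - by apply: cmp_exp => //; apply: cmp_const.
  - exact: cmp_const.
  - apply: cmp_cat; last by cmp_auto.
    apply: cmp_output; apply: cmp_run.
      by apply: (cmp_comp (f := fst) hk); cmp_auto.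
    by apply: cmp_init; apply: (cmp_comp cmp_bin); cmp_auto.
have [C hC] := cmp_computable hF.
have [c hc] := hT C I; exists c => a.
have [p [sp hp]] := hc _ _ (hC a); apply: leq_trans sp.
(* Otherwise [p] is one of the simulated inputs, and the string it outputs would be strictly longer
   than itself. *)
rewrite leqNgt; apply/negP => pe.
have [n [hn on]] := hp.
have pT : halted (run (k a) (init T p)) by apply: hd => //; exists (F a (2 ^ e a)).
have := computes_fun hp (computes_run pT) => /= E.
have lt : unbin p < 2 ^ e a.
  by apply: leq_trans (unbin_lt p) _; rewrite leq_exp2l.
have := sF a (2 ^ e a) (unbin p) lt; rewrite binK -E ltnn.
by [].
Qed.

Lemma halting_bound (T : TM) N : exists k, forall i, i < N -> dom T (bin i) ->
  forall k', k <= k' -> halted (run k' (init T (bin i))).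
Proof.
elim: N => [|N [k IH]]; first by exists 0.
have [[y /computesP[m [hm _]]]|nd] := EM (dom T (bin N)); last first.
  exists k => i; rewrite ltnS leq_eqVlt => /orP[/eqP -> //|]; exact: IH.
exists (maxn k m) => i; rewrite ltnS leq_eqVlt => /orP[/eqP -> _ k'|iN di k'].
  by rewrite geq_max => /andP[_ mk]; rewrite (run_halted hm).
by rewrite geq_max => /andP[kk _]; exact: IH.
Qed.

(* Otherwise [incompressible] would apply with [e x = 2 |x|]. *)
Lemma universal_not_total (T : TM) : universal T (fun=> True) ->
  exists x, ~ dom T x.
Proof.
move=> hT; apply: contrapT => /forallNP h.
have {}h x : dom T x by apply: contrapT.
pose e (x : raw) := (size (unraw x)).*2.
have ex_k (x : raw) : exists k, all (fun i => halted (run k (init T (bin i)))) (iota 0 (2 ^ e x)).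
  have [k hk] := halting_bound T (2 ^ e x); exists k; apply/allP => i.
  by rewrite mem_iota add0n => /hk; apply.
pose k x := ex_minn (ex_k x).
have he : cmp e.
  apply: (@cmp_ext _ _ _ _ (fun x => size (unraw x) + size (unraw x))).
    by move=> x; rewrite addnn.
  by cmp_auto.
have hk : cmp k.
  apply: (@cmp_search _ _
    (fun x k => all (fun i => halted (run k (init T (bin i)))) (iota 0 (2 ^ e x)))).
  - apply: cmp_all.
      by apply: cmp_exp; [exact: cmp_const|apply: (cmp_comp (f := fst) he); cmp_auto].
    by cmp_auto; apply: (cmp_comp cmp_bin); cmp_auto.
  - by move=> x; rewrite /k; case: ex_minnP.
  - move=> x m; rewrite /k; case: ex_minnP => n _ hn mn.
    by apply/negP => /hn; rewrite leqNgt mn.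
have [|c hc] := incompressible hT he hk.
  move=> x w sw _; rewrite /k; case: ex_minnP => n /allP + _ => /(_ (unbin w)).
  rewrite binK; apply; rewrite mem_iota add0n /=.
  by apply: leq_trans (unbin_lt w) _; rewrite leq_exp2l.
(* At length [c + 1] the bound reads [2c + 2 <= 2c + 1]. *)
have := hc (Raw (nseq c.+1 true)); rewrite /e /= size_nseq; lia.
Qed.

(** * Chebyshev's bound on the n-th prime *)

(** Serves to count exponents here, and later to express floors as numbers of integers passing a
    test. *)
Lemma sum_ltn_minn n t : \sum_(0 <= i < n) (i < t) = minn n t.
Proof.
elim: n => [|n IH]; first by rewrite big_geq // min0n.
by rewrite big_nat_recr //= IH; lia.
Qed.

Lemma next_primeP n : [/\ n < next_prime n, prime (next_prime n) &
  forall p, n < p -> prime p -> next_prime n <= p].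
Proof.
rewrite /next_prime; case: ex_minnP => p /andP[np pp] h; split=> // q nq pq.
by apply: h; rewrite nq pq.
Qed.

Lemma prime_nth_prime i : 0 < i -> prime (nth_prime i).
Proof. by case: i => //= i _; have [] := next_primeP (nth_prime i). Qed.

Lemma nth_prime_lt i j : i < j -> nth_prime i < nth_prime j.
Proof.
elim: j => // j IH; have [h _ _] := next_primeP (nth_prime j).
by rewrite ltnS leq_eqVlt => /orP[/eqP-> //|/IH ij]; exact: ltn_trans h.
Qed.

Lemma nth_prime_inj : injective nth_prime.
Proof.
by move=> i j; case: (ltngtP i j) => // /nth_prime_lt h E; rewrite E ltnn in h.
Qed.

Lemma prime_lt_nth_prime p i : prime p -> p < nth_prime i ->
  p \in [seq nth_prime k | k <- iota 1 i.-1].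
Proof.
move=> pp; elim: i => // i IH /= pi.
have [_ _ h] := next_primeP (nth_prime i).
have : p <= nth_prime i.
  by rewrite leqNgt; apply/negP => /h /(_ pp); rewrite leqNgt pi.
case: i {h pi} IH => [|i] IH; first by rewrite leqn0 => /eqP p0; rewrite p0 in pp.
rewrite leq_eqVlt => /orP[/eqP->|/IH /mapP[k]].
  by apply: map_f; rewrite mem_iota; lia.
by rewrite mem_iota => hk ->; apply: map_f; rewrite mem_iota; lia.
Qed.

(** By Legendre's formula the valuation [v] is the sum over [k >= 1] of the differences between
    [2n %/ p^k] and twice [n %/ p^k], each at most 1. If [p^v > 2n], the terms with [k >= v] vanish,
    which leaves [v <= v - 1]. *)
Lemma leq_pfactor_bin n p : prime p -> 0 < n -> p ^ logn p 'C(n.*2, n) <= n.*2.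
Proof.
move=> pp n0; set v := logn _ _; rewrite leqNgt; apply/negP => pv.
have C0 : 0 < 'C(n.*2, n) by rewrite bin_gt0; lia.
have E : v + (logn p n`! + logn p n`!) = logn p (n.*2)`!.
  have nn : n.*2 - n = n by lia.
  have nle : n <= n.*2 by lia.
  by rewrite -(bin_fact nle) nn !lognM ?muln_gt0 ?fact_gt0 ?C0.
have v0 : 0 < v by case: (v) pv => //; rewrite expn0; lia.
have {}E : v + \sum_(1 <= k < n.*2.+1) (n %/ p ^ k).*2 =
    \sum_(1 <= k < n.*2.+1) n.*2 %/ p ^ k.
  rewrite -logn_fact // -E; congr addn; rewrite !logn_fact // addnn.
  (* The sum for [n!] is extended up to [2n]; the new terms vanish, since [n < k < p^k]. *)
  rewrite [LHS](big_cat_nat (n := n.+1)) //=; last by lia.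
  rewrite [X in _ + X]big1_seq ?addn0; last first.
    move=> k; rewrite mem_index_iota => /andP[_ /andP[nk _]].
    rewrite divn_small //; apply: leq_trans nk _.
    by apply: ltnW; apply: ltn_expl; exact: prime_gt1.
  by rewrite -mul2n big_distrr; apply: eq_bigr => k _ /=; rewrite mul2n.
have : \sum_(1 <= k < n.*2.+1) n.*2 %/ p ^ k <=
    \sum_(1 <= k < n.*2.+1) ((n %/ p ^ k).*2 + (k < v)).
  apply: leq_sum => k _; case: (ltnP k v) => kv.
    rewrite addn1 -ltnS ltn_divLR ?expn_gt0 ?prime_gt0 //.
    have : n < (n %/ p ^ k).+1 * p ^ k by rewrite ltn_ceil // expn_gt0 prime_gt0.
    by move: (n %/ p ^ k) (p ^ k) => a b; nia.
  rewrite divn_small //; apply: leq_trans pv _.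
  by rewrite leq_exp2l // prime_gt1.
rewrite big_split /= -E addnC leq_add2l.
have -> : \sum_(1 <= k < n.*2.+1) (k < v) = minn n.*2 v.-1.
  by rewrite big_add1; under eq_bigr do rewrite -ltn_predRL; rewrite sum_ltn_minn.
lia.
Qed.

(** From [n] to [n + 1] the left side is multiplied by 4, and the right side by
    [4 (2n + 1) / (2n)]. *)
Lemma exp2_le_bin n : 0 < n -> 2 ^ n.*2 <= n.*2 * 'C(n.*2, n).
Proof.
elim: n => // -[|n] IH _ //.
have := IH isT; move: n.+1 => {IH}n.
have E : n.+1 * 'C(n.+1.*2, n.+1) = 2 * n.*2.+1 * 'C(n.*2, n).
  have h1 := mul_bin_diag n.+1.*2 n; have h2 := mul_bin_down n.*2.+1 n.
  have nn : n.*2.+1 - n = n.+1 by lia.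
  rewrite nn /= in h2; rewrite /= in h1.
  by apply/eqP; rewrite -(@eqn_pmul2l n.+1) //; apply/eqP; nia.
have -> : n.+1.*2 * 'C(n.+1.*2, n.+1) = 2 * (2 * n.*2.+1 * 'C(n.*2, n)).
  by rewrite -E -mul2n mulnA.
rewrite doubleS !expnS -mulnA !leq_pmul2l // => h.
by apply: leq_trans h _; rewrite leq_pmul2r ?leqnSn // bin_gt0; lia.
Qed.

(* Chebyshev's argument: ['C(2^j, 2^(j-1))] has at most as many prime factors as
   there are primes up to [2^j], and each contributes at most [2^j]. *)
Lemma nth_prime_le i j : 0 < i -> 0 < j -> j * i < 2 ^ j -> nth_prime i <= 2 ^ j.
Proof.
move=> i0; case: j => // j _ ij; rewrite leqNgt; apply/negP => pj.
pose n := 2 ^ j; have n0 : 0 < n by rewrite expn_gt0.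
have n2 : n.*2 = 2 ^ j.+1 by rewrite expnS mul2n.
pose c := 'C(n.*2, n).
have c0 : 0 < c by rewrite bin_gt0; lia.
have le_c : c <= (2 ^ j.+1) ^ i.-1.
  rewrite {1}[c]prod_prime_decomp // prime_decompE big_map /=.
  have sz : size (primes c) <= i.-1.
    rewrite -[X in _ <= X](size_iota 1) -(size_map nth_prime (iota _ _)).
    apply: uniq_leq_size; first exact: primes_uniq.
    move=> p; rewrite mem_primes => /and3P[pp _ pc].
    apply: prime_lt_nth_prime => //; apply: leq_ltn_trans pj.
    have : 0 < logn p c by rewrite logn_gt0 mem_primes pp c0.
    have := leq_pfactor_bin pp n0; rewrite -/c n2; case: logn => // k h _.
    by apply: leq_trans h; rewrite expnS leq_pmulr // expn_gt0 prime_gt0.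
  apply: leq_trans (_ : (2 ^ j.+1) ^ size (primes c) <= _); last first.
    by rewrite leq_pexp2l // expn_gt0.
  rewrite big_seq; apply: leq_trans (_ : \prod_(p <- primes c | p \in primes c) 2 ^ j.+1 <= _).
    apply: leq_prod => p; rewrite mem_primes => /and3P[pp _ _].
    by rewrite -n2; apply: leq_pfactor_bin.
  by rewrite -big_seq big_const_seq count_predT iter_muln_1.
have := exp2_le_bin n0; rewrite -/c n2 => h.
(* The factor [n.*2 = 2 ^ j.+1] from [exp2_le_bin] raises the exponent [i.-1] of [le_c] to [i]. *)
have : 2 ^ 2 ^ j.+1 <= 2 ^ (j.+1 * i).
  apply: leq_trans h _; rewrite expnM -(prednK i0) [X in _ <= X]expnS.
  by rewrite leq_pmul2l ?expn_gt0.
by rewrite leq_exp2l // leqNgt ij.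
Qed.

Import Order.TTheory GRing.Theory Num.Theory.
Import numFieldNormedType.Exports.
Local Open Scope classical_set_scope.
Local Open Scope ring_scope.

(** * Effective bounds for sums over sets of integers *)

Section ZetaSums.
Context {R : realType} (s : R) (h : nat).
Hypotheses (h0 : (0 < h)%N) (hs : 1 + h%:R^-1 <= s).
Implicit Types Q : pred nat.

Definition zsum Q (N : nat) : R := \sum_(1 <= n < N | Q n) n%:R `^ (- s).

(** An integral comparison done algebraically. With [a] and [b] the [h]-th roots of [n] and [n + 1],
    factoring [b^h - a^h = 1] gives [1 <= h (b - a) b^(h-1)], and [a <= b] does the rest. *)
Lemma powR_le_telescope (n : nat) : (0 < n)%N ->
  n.+1%:R `^ (- s) <= h%:R * ((n%:R : R) `^ (- h%:R^-1) - n.+1%:R `^ (- h%:R^-1)).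
Proof.
move=> n0; pose a : R := n%:R `^ h%:R^-1; pose b : R := n.+1%:R `^ h%:R^-1.
have hR : 0 < h%:R :> R by rewrite ltr0n.
have ah : a ^+ h = n%:R.
  by rewrite -powR_mulrn ?powR_ge0 // -powRrM mulVf ?gt_eqF // powRr1.
have bh : b ^+ h = n.+1%:R.
  by rewrite -powR_mulrn ?powR_ge0 // -powRrM mulVf ?gt_eqF // powRr1.
have a1 : 0 < a by apply: powR_gt0; rewrite ltr0n.
have b1 : 0 < b by apply: powR_gt0; rewrite ltr0n.
have ab : a <= b.
  by rewrite /a /b ge0_ler_powR ?nnegrE ?ler0n ?invr_ge0 ?ler_nat.
apply: (@le_trans _ _ (n.+1%:R `^ (- (1 + h%:R^-1)))).
  by rewrite ler_powR ?ler1n // lerN2.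
rewrite !powRN powRD ?pnatr_eq0 ?implybT // powRr1 // -/a -/b -bh.
have key : 1 <= h%:R * (b - a) * b ^+ h.-1.
  have E : b ^+ h - a ^+ h = 1 by rewrite ah bh -natr1; lra.
  rewrite -[X in X <= _]E.
  rewrite subrXX (mulrC h%:R) -(mulrA (b - a)) ler_wpM2l ?subr_ge0 //.
  apply: le_trans (_ : \sum_(i < h) b ^+ h.-1 <= _); last first.
    by rewrite sumr_const card_ord mulr_natl.
  apply: ler_sum => i _.
  have -> : b ^+ h.-1 = b ^+ (h.-1 - i) * b ^+ i.
    by rewrite -exprD; congr (_ ^+ _); have := ltn_ord i; lia.
  have -> : (h.-1 - i = h - i.+1)%N by lia.
  by rewrite ler_wpM2l ?exprn_ge0 ?lerXn2r ?nnegrE // ltW.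
have -> : a^-1 - b^-1 = (b - a) / (a * b) by field; rewrite !gt_eqF.
rewrite -[h in b ^+ h](prednK h0) exprS invfM.
have bh1 : 0 < b ^+ h.-1 by rewrite exprn_gt0.
rewrite mulrA ler_pdivlMr ?mulr_gt0 //.
have -> : (b * b ^+ h.-1)^-1 / b * (a * b) = (a / b) * (b ^+ h.-1)^-1.
  by field; rewrite !gt_eqF.
rewrite ler_pdivrMr //; apply: le_trans key.
by rewrite ler_pdivrMr // mul1r.
Qed.

Lemma zsum_nondecreasing Q : nondecreasing_seq (zsum Q).
Proof.
apply/nondecreasing_seqP => -[|N]; first by rewrite /zsum !big_geq.
rewrite /zsum big_mkcond [leRHS]big_mkcond /= [leRHS]big_nat_recr //= lerDl.
by case: (Q _) => //; exact: powR_ge0.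
Qed.

Lemma zsum_tail Q m k : (0 < m)%N ->
  zsum Q (m.+1 + k) <=
  zsum Q m.+1 + h%:R * ((m%:R : R) `^ (- h%:R^-1) - (m + k)%:R `^ (- h%:R^-1)).
Proof.
move=> m0; elim: k => [|k IH]; first by rewrite !addn0 subrr mulr0 addr0.
have le1 : zsum Q (m.+1 + k.+1) <= zsum Q (m.+1 + k) + (m.+1 + k)%:R `^ (- s).
  rewrite /zsum addnS big_mkcond [X in _ <= X + _]big_mkcond /=.
  rewrite big_nat_recr //= lerD2l; case: (Q _) => //; exact: powR_ge0.
apply: (le_trans le1); rewrite addSn.
have := @powR_le_telescope (m + k) (ltn_addr k m0).
rewrite addnS; move: IH; rewrite addSn.
lra.
Qed.

(** Cutting at an [h]-th power makes the tail bound rational, so that a machine can use it. *)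
Lemma zsum_le Q L N : (0 < L)%N -> zsum Q N <= zsum Q (L ^ h).+1 + h%:R / L%:R.
Proof.
move=> L0; have hR : 0 < h%:R :> R by rewrite ltr0n.
have Lh : (0 < L ^ h)%N by rewrite expn_gt0 L0.
apply: (@le_trans _ _ (zsum Q ((L ^ h).+1 + N))).
  by apply: zsum_nondecreasing; rewrite leq_addl.
apply: (le_trans (zsum_tail Q N Lh)); rewrite lerD2l (ler_wpM2l (ltW hR)) //.
have -> : ((L ^ h)%:R : R) `^ (- h%:R^-1) = L%:R^-1.
  rewrite powRN natrX -powR_mulrn ?ler0n // -powRrM mulfV ?gt_eqF //.
  by rewrite powRr1 ?ler0n.
by rewrite gerBl powR_ge0.
Qed.

Lemma zsum_cvg Q : cvgn (zsum Q).
Proof.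
apply: nondecreasing_is_cvgn; first exact: zsum_nondecreasing.
exists (zsum Q (1 ^ h).+1 + h%:R / 1%:R) => _ [N _ <-].
exact: zsum_le.
Qed.

Definition zlim Q : R := limn (zsum Q).

Lemma zsum_le_lim Q N : zsum Q N <= zlim Q.
Proof.
apply: nondecreasing_cvgn_le; [exact: zsum_nondecreasing|exact: zsum_cvg].
Qed.

Lemma zlim_le Q L : (0 < L)%N -> zlim Q <= zsum Q (L ^ h).+1 + h%:R / L%:R.
Proof.
move=> L0; apply: limr_le; first exact: zsum_cvg.
by near=> N; exact: zsum_le.
Unshelve. all: by end_near.
Qed.

Lemma zsum_addr Q i N : (0 < i)%N -> Q i -> exists M,
  zsum (fun n => Q n && (n != i)) N + i%:R `^ (- s) <= zsum Q M.
Proof.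
move=> i0 Qi; exists (maxn N i.+1).
apply: (@le_trans _ _ (zsum (fun n => Q n && (n != i)) (maxn N i.+1) + i%:R `^ (- s))).
  by rewrite lerD2r; apply: zsum_nondecreasing; rewrite leq_maxl.
rewrite /zsum [leRHS]big_mkcond (bigD1_seq i) ?iota_uniq //=; last first.
  by rewrite mem_index_iota i0 leq_maxr.
rewrite Qi [leRHS]addrC lerD2r -big_mkcondr /=.
by rewrite le_eqVlt; apply/orP; left; apply/eqP/eq_bigl => n; rewrite andbC.
Qed.

Lemma zsum_sub Q Q' N : (forall n, (0 < n)%N -> Q n -> Q' n) -> zsum Q N <= zsum Q' N.
Proof.
move=> QQ; rewrite /zsum big_mkcond [leRHS]big_mkcond /= big_seq [leRHS]big_seq.
apply: ler_sum => i; rewrite mem_index_iota => /andP[i0 _].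
by case: (boolP (Q i)) => [/(QQ _ i0)-> //|_]; case: ifP => // _; exact: powR_ge0.
Qed.

Lemma zsum_lt_lim Q Q' i N : (0 < i)%N -> Q' i -> ~~ Q i ->
  (forall n, (0 < n)%N -> Q n -> Q' n) -> zsum Q N + i%:R `^ (- s) <= zlim Q'.
Proof.
move=> i0 Qi' nQi QQ; have [M hM] := zsum_addr N i0 Qi'.
apply: le_trans (zsum_le_lim Q' M); apply: le_trans hM.
rewrite lerD2r; apply: zsum_sub => n n0 Qn; rewrite QQ //=.
by apply: contraNneq nQi => <-.
Qed.

End ZetaSums.

(* The integer part of [2^l n^(-e / 2^(l+1))], computed without roots. *)
Definition root_pow (n e l : nat) : nat :=
  \sum_(0 <= c < 2 ^ l) (c.+1 ^ (2 ^ l.+1) * n ^ e <= (2 ^ l) ^ (2 ^ l.+1))%N.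

Lemma root_powP (R : realType) (n e l : nat) : (0 < n)%N ->
  (root_pow n e l)%:R / 2 ^+ l <= n%:R `^ (- (e%:R / 2 ^+ l.+1)) :> R /\
  n%:R `^ (- (e%:R / 2 ^+ l.+1)) <= (root_pow n e l).+1%:R / 2 ^+ l :> R.
Proof.
move=> n0; set D := (2 ^ l)%N; set v := (2 ^ l.+1)%N.
have DR : D%:R = 2 ^+ l :> R by rewrite natrX.
have vR : v%:R = 2 ^+ l.+1 :> R by rewrite natrX.
have D0 : 0 < D%:R :> R by rewrite ltr0n expn_gt0.
have v0 : 0 < v%:R :> R by rewrite ltr0n expn_gt0.
have vN : (0 < v)%N by rewrite /v expn_gt0.
have nR : 0 < n%:R :> R by rewrite ltr0n.
rewrite -DR -vR; set x := n%:R `^ _.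
have x0 : 0 < x by apply: powR_gt0.
have x1 : x <= 1.
  by rewrite -(powRr0 n%:R) ler_powR ?ler1n // oppr_le0 divr_ge0 ?ler0n.
have xv : x ^+ v * n%:R ^+ e = 1.
  rewrite -powR_mulrn ?ltW // -powRrM mulNr divfK ?gt_eqF // powRN powR_mulrn ?ltW //.
  by rewrite mulVf // expf_neq0 ?gt_eqF.
have y0 : 0 <= D%:R * x by rewrite mulr_ge0 ?ltW.
(* Both sides of [c + 1 <= D x] are raised to the power [v], using [x^v n^e = 1]. *)
have cE c : (c.+1 ^ v * n ^ e <= D ^ v)%N = (c.+1%:R <= D%:R * x).
  rewrite -(ler_nat R) natrM (natrX _ D) (natrX _ n) (natrX _ c.+1).
  rewrite -[RHS](ler_pXn2r vN) ?nnegrE ?ler0n ?y0 //.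
  have Dv : D%:R ^+ v * x ^+ v * n%:R ^+ e = D%:R ^+ v by rewrite -mulrA xv mulr1.
  by rewrite exprMn -[in LHS]Dv ler_pM2r // exprn_gt0.
pose t := Num.trunc (D%:R * x).
have ut : root_pow n e l = t.
  (* As [x <= 1], the range [c < D] of the sum is wide enough to count up to the floor [t]. *)
  have tD : (t <= D)%N.
    rewrite -(ler_nat R); apply: (@le_trans _ _ (D%:R * x)).
      by rewrite truncn_le.
    by rewrite -[leRHS]mulr1 ler_wpM2l // ltW.
  have -> : root_pow n e l = (\sum_(0 <= c < D) (c < t))%N.
    by apply: eq_bigr => c _; rewrite cE /t truncn_gt_nat.
  by rewrite sum_ltn_minn (minn_idPr tD).
have /andP[t1 t2] := truncn_itv y0.
rewrite ut ler_pdivrMr // ler_pdivlMr // ![x * _]mulrC.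
by split; [|apply: ltW].
Qed.

Lemma cvg_half_pow (R : realType) : 2 ^- l @[l --> \oo] --> (0 : R).
Proof.
under eq_fun do rewrite -exprVn.
by apply: cvg_expr; rewrite ger0_norm ?invr_ge0 //; lra.
Qed.

Section Approximation.
Context {R : realType} (s : R) (sa : nat -> nat).
Hypothesis s0 : 0 <= s.
Hypothesis hsa : forall l, `|s - (sa l)%:R / 2 ^+ l.+1| <= 2 ^- l.+1.

(** The exponent is rounded away from the wanted side: up for lower bounds, down for upper bounds.
    The predecessor of 0 is 0, which is still a lower bound for [s] as [0 <= s]. *)
Definition lower_pow (n l : nat) : nat := root_pow n (sa l).+1 l.
Definition upper_pow (n l : nat) : nat := (root_pow n (sa l).-1 l).+1.

Lemma approx_bounds l :
  ((sa l).-1%:R / 2 ^+ l.+1 <= s <= (sa l).+1%:R / 2 ^+ l.+1) /\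
  (s - 2 ^- l <= (sa l).-1%:R / 2 ^+ l.+1 /\ (sa l).+1%:R / 2 ^+ l.+1 <= s + 2 ^- l).
Proof.
have := hsa l; rewrite ler_norml.
have -> : (2 ^- l : R) = 2 * 2 ^- l.+1.
  by rewrite exprS invfM mulrA mulfV ?mul1r.
have p0 : 0 < 2 ^- l.+1 :> R by rewrite invr_gt0 exprn_gt0.
set e := 2 ^- l.+1 in p0 *; move=> /andP[h1 h2].
have u : (sa l).+1%:R * e = (sa l)%:R * e + e by rewrite -natr1 mulrDl mul1r.
have [a0|a0] := posnP (sa l).
  rewrite a0 /= ?mul0r in u h1 h2 *; rewrite u; split; [apply/andP|]; split; first [exact: s0|lra].
have d : (sa l).-1%:R * e = (sa l)%:R * e - e.
  by rewrite -[in RHS](prednK a0) -natr1 mulrDl mul1r addrK.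
by rewrite u d; split; [apply/andP|]; split; lra.
Qed.

Lemma cvg_powR_near (n : nat) (d : R) : (0 < n)%N ->
  n%:R `^ (- (s + d * 2 ^- l)) @[l --> \oo] --> n%:R `^ (- s).
Proof.
move=> n0.
rewrite /powR pnatr_eq0 gtn_eqF //.
apply: continuous_cvg; first exact: continuous_expR.
apply: cvgM; last exact: cvg_cst.
rewrite -[in X in _ --> X](addr0 s) -[in X in _ --> X](mulr0 d).
by apply: cvgN; apply: cvgD; 
  [exact: cvg_cst|apply: cvgM; [exact: cvg_cst|exact: cvg_half_pow]].
Qed.

Lemma lower_powP n l : (0 < n)%N ->
  (lower_pow n l)%:R / 2 ^+ l <= n%:R `^ (- s) /\
  n%:R `^ (- (s + 2 ^- l)) - 2 ^- l <= (lower_pow n l)%:R / 2 ^+ l.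
Proof.
move=> n0; have [h1 h2] := @root_powP R n (sa l).+1 l n0.
have [/andP[_ b1] [_ b2]] := approx_bounds l; split.
  by apply: (le_trans h1); rewrite ler_powR ?ler1n // lerN2.
have h3 : n%:R `^ (- (s + 2 ^- l)) <= n%:R `^ (- ((sa l).+1%:R / 2 ^+ l.+1)) :> R.
  by rewrite ler_powR ?ler1n // lerN2.
rewrite lerBlDr; apply: (le_trans h3); apply: (le_trans h2).
by rewrite -natr1 mulrDl mul1r.
Qed.

Lemma upper_powP n l : (0 < n)%N ->
  n%:R `^ (- s) <= (upper_pow n l)%:R / 2 ^+ l /\
  (upper_pow n l)%:R / 2 ^+ l <= n%:R `^ (- (s + -1 * 2 ^- l)) + 2 ^- l.
Proof.
move=> n0; have [h1 h2] := @root_powP R n (sa l).-1 l n0.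
have [/andP[b1 _] [b2 _]] := approx_bounds l; split.
  by apply: le_trans h2; rewrite ler_powR ?ler1n // lerN2.
have h3 : n%:R `^ (- ((sa l).-1%:R / 2 ^+ l.+1)) <= n%:R `^ (- (s + -1 * 2 ^- l)) :> R.
  by rewrite ler_powR ?ler1n // lerN2 mulN1r.
by rewrite /upper_pow -natr1 mulrDl mul1r lerD2r; apply: (le_trans h1).
Qed.

Lemma lower_pow_cvg n : (0 < n)%N ->
  (lower_pow n l)%:R / 2 ^+ l @[l --> \oo] --> (n%:R `^ (- s) : R).
Proof.
move=> n0.
apply: (@squeeze_cvgr _ _ _ _ (fun l => n%:R `^ (- (s + 1 * 2 ^- l)) - 2 ^- l)
  (fun l => n%:R `^ (- s))); last exact: cvg_cst.
  near=> l; have [h1 h2] := lower_powP l n0; apply/andP; split=> //.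
  by rewrite mul1r.
rewrite -[X in _ --> X]subr0; apply: cvgB; first exact: cvg_powR_near.
exact: cvg_half_pow.
Unshelve. all: by end_near.
Qed.

Lemma upper_pow_cvg n : (0 < n)%N ->
  (upper_pow n l)%:R / 2 ^+ l @[l --> \oo] --> (n%:R `^ (- s) : R).
Proof.
move=> n0.
apply: (@squeeze_cvgr _ _ _ _ (fun l => n%:R `^ (- s))
  (fun l => n%:R `^ (- (s + -1 * 2 ^- l)) + 2 ^- l)); first last.
- rewrite -[X in _ --> X]addr0; apply: cvgD; first exact: cvg_powR_near.
  exact: cvg_half_pow.
- exact: cvg_cst.
near=> l; have [h1 h2] := upper_powP l n0; apply/andP; split=> //.
Unshelve. all: by end_near.
Qed.

Definition lower_sum (Q : pred nat) N l : nat :=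
  (\sum_(1 <= n < N | Q n) lower_pow n l)%N.
Definition upper_sum N l : nat := (\sum_(1 <= n < N) upper_pow n l)%N.

Lemma lower_sum_le Q N l : (lower_sum Q N l)%:R / 2 ^+ l <= zsum s Q N.
Proof.
rewrite natr_sum mulr_suml /zsum big_seq_cond [leRHS]big_seq_cond.
apply: ler_sum => n; rewrite mem_index_iota => /andP[/andP[n0 _] _].
by have [] := lower_powP l n0.
Qed.

Lemma upper_sum_ge N l : zsum s xpredT N <= (upper_sum N l)%:R / 2 ^+ l.
Proof.
rewrite natr_sum mulr_suml /zsum big_seq_cond [leRHS]big_seq_cond.
apply: ler_sum => n; rewrite mem_index_iota => /andP[/andP[n0 _] _].
by have [] := upper_powP l n0.
Qed.

Lemma lower_sum_cvg Q N :
  (lower_sum Q N l)%:R / 2 ^+ l @[l --> \oo] --> zsum s Q N.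
Proof.
under eq_fun do rewrite natr_sum mulr_suml big_nat_cond.
rewrite /zsum big_nat_cond; apply: cvg_big; first exact: add_continuous.
by move=> n /andP[/andP[n0 _] _]; exact: lower_pow_cvg.
Qed.

Lemma upper_sum_cvg N :
  (upper_sum N l)%:R / 2 ^+ l @[l --> \oo] --> zsum s xpredT N.
Proof.
under eq_fun do rewrite natr_sum mulr_suml big_nat_cond.
rewrite /zsum big_nat_cond; apply: cvg_big; first exact: add_continuous.
by move=> n /andP[/andP[n0 _] _]; exact: upper_pow_cvg.
Qed.

Variable h : nat.
Hypotheses (h0 : (0 < h)%N) (hs : 1 + h%:R^-1 <= s).

(* The upper bounds for [zeta s] use the tail estimate [zlim_le]. *)
Lemma search_near Q (q : R) : 0 <= q -> q * zlim s xpredT < zlim s Q ->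
  exists2 L, (0 < L)%N & \forall l \near \oo,
    q * ((upper_sum (L ^ h).+1 l)%:R / 2 ^+ l + h%:R / L%:R) <
    (lower_sum Q (L ^ h).+1 l)%:R / 2 ^+ l.
Proof.
move=> q0 qlt; set d := zlim s Q - q * zlim s xpredT.
have d0 : 0 < d by rewrite subr_gt0.
have [N hN] : exists N, zlim s Q - d / 2 < zsum s Q N.
  apply: contrapT => /forallNP hN.
  have : zlim s Q <= zlim s Q - d / 2.
    apply: limr_le; first exact: (zsum_cvg h0 hs).
    by near=> N; rewrite leNgt; apply/negP/hN.
  by lra.
(* Half of the gap [d] pays for cutting the sum over [Q] at [N], the other half for [q * h / L]. *)
pose L := maxn N.+1 (Num.trunc (q * h%:R / (d / 2))).+1.
have L0 : (0 < L)%N by rewrite /L leq_max.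
exists L => //.
have LR : 0 < L%:R :> R by rewrite ltr0n.
have qh : q * (h%:R / L%:R) < d / 2.
  rewrite mulrA ltr_pdivrMr // [ltRHS]mulrC -ltr_pdivrMr; last by lra.
  have y0 : 0 <= q * h%:R / (d / 2) by rewrite !mulr_ge0 ?invr_ge0 //; lra.
  have /andP[_ t2] := truncn_itv y0; apply: (lt_le_trans t2).
  by rewrite ler_nat leq_max leqnn orbT.
have NL : (N <= (L ^ h).+1)%N.
  apply: (@leq_trans L); first by rewrite /L leq_max leqnSn.
  by rewrite -[X in (X <= _)%N]expn1 (leq_trans (leq_pexp2l L0 h0)).
have lt1 : q * (zsum s xpredT (L ^ h).+1 + h%:R / L%:R) < zsum s Q (L ^ h).+1.
  have h1 : zsum s Q N <= zsum s Q (L ^ h).+1 by apply: zsum_nondecreasing.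
  have h2 : q * zsum s xpredT (L ^ h).+1 <= q * zlim s xpredT.
    by rewrite ler_wpM2l // (zsum_le_lim h0 hs).
  by rewrite mulrDr; move: hN qh h1 h2; rewrite /d; lra.
have c1 : q * ((upper_sum (L ^ h).+1 l)%:R / 2 ^+ l + h%:R / L%:R) @[l --> \oo] -->
    q * (zsum s xpredT (L ^ h).+1 + h%:R / L%:R).
  apply: cvgM; first exact: cvg_cst.
  by apply: cvgD; [exact: upper_sum_cvg|exact: cvg_cst].
have := cvgr_gt _ (cvgB (@lower_sum_cvg Q (L ^ h).+1) c1) 0.
rewrite subr_gt0 => /(_ _ _ lt1) H.
by near=> l; rewrite -subr_gt0; near: l; exact: H.
Unshelve. all: by end_near.
Qed.

End Approximation.

(** * Unending binary expansions *)

Definition binary_value (x : string) : nat :=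
  foldl (fun (a : nat) (b : bool) => (b + a.*2)%N) 0%N x.

(** Greedy choice with a strict test: a digit is 1 when the value obtained stays strictly below
    [alpha]. Dyadic reals thus get the expansion ending in ones. *)
Lemma unending_expansion_ex (R : realType) (alpha : R) : 0 < alpha < 1 ->
  exists2 d, unending_expansion alpha d & forall m,
    (binary_value (mkseq d m))%:R / 2 ^+ m < alpha /\
    alpha <= (binary_value (mkseq d m))%:R / 2 ^+ m + 2 ^- m.
Proof.
move=> /andP[a0 a1].
pose next (c m : nat) : bool := c.*2.+1%:R / 2 ^+ m.+1 < alpha.
pose c := fix c m := if m is k.+1 then (next (c k) k + (c k).*2)%N else 0%N.
pose d m := next (c m) m.
have cS m : c m.+1 = (d m + (c m).*2)%N by [].
have valE m : binary_value (mkseq d m) = c m.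
  elim: m => // m IH; rewrite cS -IH /binary_value /mkseq -addn1 iotaD map_cat.
  by rewrite foldl_cat.
have hc m : (c m)%:R / 2 ^+ m < alpha /\ alpha <= (c m)%:R / 2 ^+ m + 2 ^- m.
  elim: m => [|m [IH1 IH2]]; first by rewrite expr0 mul0r invr1 add0r; split=> //; apply: ltW.
  have e2 : 2 ^- m = 2 * 2 ^- m.+1 :> R by rewrite exprS invfM mulrA mulfV ?mul1r.
  rewrite cS natrD -muln2 natrM; move: IH1 IH2; rewrite e2.
  have : d m = ((c m).*2.+1%:R / 2 ^+ m.+1 < alpha) by [].
  rewrite -muln2 -natr1 natrM; case: ltP => + -> /=; nra.
have small (e : R) : 0 < e -> exists N, forall j, (N <= j)%N -> 2 ^- j < e.
  move=> e0; have := @cvgr_lt _ _ _ _ _ 0 (@cvg_half_pow R) e e0.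
  by move=> [N _ hN]; exists N => j Nj; apply: hN.
exists d; last by move=> m; rewrite valE.
split.
  (* If all digits vanish from [i] on, the prefix values stay constant, at a positive distance from
     [alpha] that [2 ^- m] eventually undercuts. *)
  move=> i; apply: contrapT => h.
  have dF j : (i <= j)%N -> d j = false.
    by move=> ij; apply/negP => dj; apply: h; exists j.
  have cE k : (c (i + k)%N)%:R / 2 ^+ (i + k) = (c i)%:R / 2 ^+ i :> R.
    elim: k => [|k IH]; first by rewrite addn0.
    rewrite addnS cS dF ?leq_addr // add0n -muln2 natrM exprS -IH invfM.
    by rewrite mulrA -(mulrA (c (i + k)%N)%:R) mulfV // mulr1.
  have [h1 _] := hc i.
  have lt0 : 0 < alpha - (c i)%:R / 2 ^+ i by rewrite subr_gt0.
  have [N hN] := small _ lt0.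
  have [_] := hc (i + N)%N; have := hN (i + N)%N (leq_addl _ _).
  rewrite cE; lra.
have serE : series (fun i => (d i)%:R / 2 ^+ i.+1 : R) = (fun m => (c m)%:R / 2 ^+ m).
  apply/funext => m; rewrite /series /=; elim: m => [|m IH].
    by rewrite big_geq // mul0r.
  rewrite big_nat_recr // IH cS natrD -muln2 natrM mulrDl addrC; congr (_ + _).
  by rewrite exprS invfM mulrA -(mulrA (c m)%:R) mulfV // mulr1.
rewrite serE; apply: (@squeeze_cvgr _ _ _ _ (fun m => alpha - 2 ^- m) (fun=> alpha)).
- near=> m; have [h1 h2] := hc m; apply/andP; split; last exact: ltW.
  by rewrite lerBlDr.
- rewrite -[X in _ --> X]subr0; apply: cvgB; [exact: cvg_cst|exact: cvg_half_pow].
- exact: cvg_cst.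
Unshelve. all: by end_near.
Qed.

(** * The search for a stage of the enumeration *)

(** The machine is simulated until it halts. Thus machines given by hypothesis, such as the one
    approximating [s] and [T] itself, can be called by programs. *)
Lemma cmp_eval (M : TM) A (eA : enc A) (x y : A -> string) :
  cmp x -> (forall a, computes M (x a) (y a)) -> cmp y.
Proof.
move=> hx hy.
have ex a : exists n, halted (run n (init M (x a))).
  by have /computesP[n [hn _]] := hy a; exists n.
pose mu a := ex_minn (ex a).
have hmu : cmp mu.
  apply: (@cmp_search _ _ (fun a n => halted (run n (init M (x a))))).
  - by cmp_auto; apply: (cmp_comp (f := fst) hx); cmp_auto.
  - by move=> a; rewrite /mu; case: ex_minnP.
  - move=> a m; rewrite /mu; case: ex_minnP => n _ hn mn.
    by apply/negP => /hn; rewrite leqNgt mn.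
apply: (@cmp_ext _ _ _ _ (fun a => output (run (mu a) (init M (x a))))).
  move=> a; apply: computes_fun (hy a); apply: computes_run.
  by rewrite /mu; case: ex_minnP.
by cmp_auto.
Qed.

Lemma computable_real_approx (R : realType) (s : R) : computable_real s -> 1 < s ->
  exists2 sa : nat -> nat, cmp sa &
    forall l, `|s - (sa l)%:R / 2 ^+ l.+1| <= 2 ^- l.+1.
Proof.
move=> [M hM] s1.
have /choice[y hy] l : exists y : string,
    computes M (bin l.+1) y /\
    `|s - (unbin (behead y)).-1%:R / 2 ^+ l.+1| <= 2 ^- l.+1.
  have [b [a [h1 h2]]] := hM l.+1 isT; exists (b :: bin a.+1).
  split=> //; rewrite [behead _]/= unbinK //=.
  case: b {h1} h2 => /=; rewrite ?expr0 ?mul1r // expr1 !mulN1r mulNr opprK => h.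
  have p0 : 0 < 2 ^+ l.+1 :> R by rewrite exprn_gt0.
  have p1 : 2 ^- l.+1 <= 1 :> R by rewrite invf_le1 // exprn_ege1 // ler1n.
  have a0 : 0 <= a%:R / 2 ^+ l.+1 :> R by rewrite divr_ge0 ?ler0n // ltW.
  by move: h; rewrite ger0_norm; lra.
exists (fun l => (unbin (behead (y l))).-1); last by move=> l; have [] := hy l.
apply: cmp_pred; apply: cmp_unbin; apply: cmp_behead.
apply: (@cmp_eval M _ _ (fun l => bin l.+1)); last by move=> l; have [] := hy l.
by apply: (cmp_comp cmp_bin); cmp_auto.
Qed.

Lemma cmp_divn A (eA : enc A) (m : A -> nat) d : (0 < d)%N -> cmp m ->
  cmp (fun a => m a %/ d)%N.
Proof.
move=> d0 hm; apply: (@cmp_ext _ _ _ _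
  (fun a => \sum_(0 <= i < m a) (i.+1 * d <= m a))%N).
  move=> a; under eq_bigr do rewrite -leq_divRL //.
  by rewrite sum_ltn_minn (minn_idPr (leq_div (m a) d)).
apply: cmp_sum => //; cmp_auto.
by apply: (cmp_comp (f := fst) hm); cmp_auto.
Qed.

Lemma cmp_binary_value A (eA : enc A) (x : A -> string) :
  cmp x -> cmp (fun a => binary_value (x a)).
Proof.
move=> hx; apply: (cmp_foldl (f := fun _ (a : nat) (b : bool) => (b + a.*2)%N)); cmp_auto.
apply: (@cmp_ext _ _ _ _
  (fun p : A * (nat * bool) => p.2.1 + p.2.1)%N); last by cmp_auto.
by move=> p; rewrite addnn.
Qed.

(** Bounds the indices of the prime factors of [n] by [n], which makes the test of [stage]
    finite. *)
Lemma leq_nth_prime i : (i <= nth_prime i)%N.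
Proof.
elim: i => // i IH; apply: leq_ltn_trans IH _; exact: nth_prime_lt.
Qed.

Lemma dom_prime_product (P : pfun) n : (0 < n)%N -> dom (prime_product P) (bin n) <->
  (forall i, (0 < i)%N -> (nth_prime i %| n)%N -> dom P (bin i)).
Proof.
move=> n0; split=> [[y [k [k0 E h _]]]|h]; last by exists [::], n.
by rewrite -(unbinK n0) E unbinK.
Qed.

(* The integers found after [k] steps of the enumeration of the domain of the
   prime product machine. *)
Definition stage (T : TM) k n : bool :=
  all (fun i => if (nth_prime i.+1 %| n)%N
                then halted (run k (init T (bin i.+1))) else true) (iota 0 n).

Lemma cmp_stage T A (eA : enc A) (k n : A -> nat) :
  cmp k -> cmp n -> cmp (fun a => stage T (k a) (n a)).
Proof.
move=> hk hn; apply: cmp_all => //; apply: cmp_if; last exact: cmp_const.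
  apply: cmp_dvdn; first by apply: (cmp_comp cmp_nth_prime); cmp_auto.
  by apply: (cmp_comp (f := fst) hn); cmp_auto.
cmp_auto; first by apply: (cmp_comp (f := fst) hk); cmp_auto.
by apply: (cmp_comp cmp_bin); cmp_auto.
Qed.

Lemma stageP T k n : (0 < n)%N -> reflect
  (forall i, (0 < i)%N -> (nth_prime i %| n)%N -> halted (run k (init T (bin i))))
  (stage T k n).
Proof.
move=> n0; apply: (iffP allP) => h.
  move=> [//|i] _ di; have := h i; rewrite di; apply.
  by rewrite mem_iota add0n; apply: leq_trans (leq_nth_prime i.+1) (dvdn_leq n0 di).
by move=> i _; case: ifP => // di; apply: h.
Qed.

Lemma stage_near (T : TM) N : exists k, forall k' n, (k <= k')%N -> (0 < n < N)%N ->
  dom (prime_product T) (bin n) -> stage T k' n.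
Proof.
have [k hk] := halting_bound T N; exists k => k' n kk /andP[n0 nN].
move=> /(dom_prime_product _ n0) h; apply/stageP => // i i0 di.
apply: hk (h i i0 di) _ kk; apply: leq_ltn_trans nN.
exact: leq_trans (leq_nth_prime i) (dvdn_leq n0 di).
Qed.

Lemma stage_dom (T : TM) k n : (0 < n)%N -> stage T k n -> dom (prime_product T) (bin n).
Proof.
move=> n0 /(stageP _ _ n0) h; apply/dom_prime_product => // i i0 di.
by eexists; apply: computes_run (h i i0 di).
Qed.

(** The factor [j] of Chebyshev's bound costs only the fraction [1/w] of [j] bits, up to a
    constant. *)
Lemma ltn_exp_div w j : (0 < w)%N -> (j < 2 ^ (w + j %/ w))%N.
Proof.
move=> w0; apply: leq_trans (ltn_ceil j w0) _; rewrite expnD mulnC.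
by apply: leq_mul; [apply: ltnW|]; exact: ltn_expl.
Qed.

Lemma natr_div_le (R : realType) m d : (m %/ d)%:R <= m%:R / d%:R :> R.
Proof.
case: d => [|d]; first by rewrite divn0 invr0 mulr0.
by rewrite ler_pdivlMr ?ltr0n // -natrM ler_nat leq_divM.
Qed.

Lemma natr_div_gt (R : realType) m d : (0 < d)%N ->
  m%:R / d%:R < (m %/ d).+1%:R :> R.
Proof.
by move=> d0; rewrite ltr_pdivrMr ?ltr0n // -natrM ltr_nat ltn_ceil.
Qed.

Lemma ltr_truncS (R : realType) (x : R) : 0 <= x -> x < (Num.trunc x).+1%:R.
Proof. by move=> /truncn_itv/andP[]. Qed.

(* With [kappa = 1 - 1/w], the slope [u / v] is chosen in
   [(1/t, kappa/s)]; then [j ~ m/s] leaves room for the factor [j]. *)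
Lemma exponent_choice (R : realType) (s t Z : R) : 1 < s -> s < t -> 0 < Z ->
  exists u v c, (0 < v)%N /\ forall m,
    m%:R / t - c.+1%:R <= (m * u %/ v - c)%N%:R /\
    ((0 < m * u %/ v - c)%N -> exists j,
       [/\ (0 < j)%N, (j * 2 ^ (m * u %/ v - c) < 2 ^ j)%N &
           Z * 2 `^ (- m%:R) < 2 `^ (- (j%:R * s))]).
Proof.
move=> s1 st Z0.
have s0 : 0 < s by lra.
have t0 : 0 < t by lra.
pose g := s^-1 - t^-1.
have g0 : 0 < g by rewrite subr_gt0 ltf_pV2.
have is1 : s^-1 < 1 by rewrite invf_lt1.
have is0 : 0 < s^-1 by rewrite invr_gt0.
have it0 : 0 < t^-1 by rewrite invr_gt0.
(* With [1/w < g/2], the slope [r <= 1/t + 1/w] stays below [1/s - 1/w], hence below [k/s]. *)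
pose w := (Num.trunc (2 / g)).+1.
have w0 : 0 < w%:R :> R by rewrite ltr0n.
have iw : w%:R^-1 < g / 2.
  rewrite -[ltRHS]invrK ltf_pV2 ?posrE ?invr_gt0 ?divr_gt0 // invfM invrK mulrC.
  by apply: ltr_truncS; rewrite divr_ge0 // ltW.
have iw0 : 0 < w%:R^-1 :> R by rewrite invr_gt0.
pose u := (Num.trunc (w%:R / t)).+1.
have wt0 : 0 <= w%:R / t by rewrite divr_ge0 // ltW.
pose r : R := u%:R / w%:R.
have r1 : t^-1 < r.
  by rewrite /r ltr_pdivlMr // [ltLHS]mulrC; exact: ltr_truncS.
have r2 : r <= t^-1 + w%:R^-1.
  have /andP[h _] := truncn_itv wt0.
  by rewrite /r ler_pdivrMr // mulrDl mulVf ?gt_eqF // -natr1 lerD2r [leRHS]mulrC.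
pose k : R := 1 - w%:R^-1.
have k1 : k <= 1 by rewrite /k; lra.
have k0 : 0 <= k.
  by rewrite subr_ge0 invf_le1 // ler1n.
have r3 : r <= k * s^-1.
  have h : w%:R^-1 * s^-1 <= w%:R^-1 by rewrite ler_piMr // ltW.
  by rewrite /k mulrBl mul1r; move: r2 iw h; rewrite /g; lra.
pose c0 := (Num.trunc Z).+1.
have Zc : Z < 2 ^+ c0.
  apply: lt_trans (ltr_truncS (ltW Z0)) _.
  by rewrite -natrX ltr_nat; apply: ltn_expl.
(* In the constant, [c0] pays for [Z], [w] for the factor [j] through [ltn_exp_div], and 1 for
   rounding [y] down to [j]. *)
exists u, w, (c0 + w.+1)%N; split=> // m; set c := (c0 + w.+1)%N; set q := (m * u %/ w)%N.
have cE : c%:R = c0%:R + w%:R + 1 :> R by rewrite natrD -natr1 addrA.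
have mu : (m * u)%:R / w%:R = m%:R * r :> R by rewrite natrM /r mulrA.
have m0 : 0 <= m%:R :> R by [].
have q1 : q%:R <= m%:R * r by rewrite -mu natr_div_le.
have q2 : m%:R * r < q%:R + 1 by rewrite -mu natr1 natr_div_gt.
have mr : m%:R * t^-1 <= m%:R * r by rewrite ler_wpM2l // ltW.
have qc : q%:R - c%:R <= (q - c)%N%:R :> R.
  by rewrite lerBlDr -natrD ler_nat addnC -leq_subLR.
split; first by rewrite -natr1; lra.
move=> e0; have cq : (c < q)%N by rewrite -subn_gt0.
have eE : (q - c)%N%:R = q%:R - c%:R :> R by rewrite natrB // ltnW.
have cqR : c%:R <= q%:R :> R by rewrite ler_nat ltnW.
have mk : m%:R * r <= k * (m%:R * s^-1).
  by rewrite [leRHS]mulrCA ler_wpM2l.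
have ms : m%:R * s^-1 <= m%:R by rewrite ler_piMr // ltW.
have kms : k * (m%:R * s^-1) <= m%:R * s^-1.
  by rewrite ler_piMl // mulr_ge0 // ltW.
have c0m : c0%:R <= m%:R :> R by move: w0; lra.
(* The largest real exponent with [2^(c0 - m) <= 2^(- y s)]. *)
pose y := (m%:R - c0%:R) / s.
have y0 : 0 <= y by rewrite divr_ge0 ?subr_ge0 // ltW.
pose j := Num.trunc y.
have j1 : j%:R <= y by rewrite truncn_le.
have j2 : y < j%:R + 1 by rewrite natr1; exact: ltr_truncS.
have js : j%:R * s <= m%:R - c0%:R by rewrite -ler_pdivlMr.
have main : (q - c + (w + j %/ w) <= j)%N.
  rewrite -(ler_nat R) natrD eE cE natrD.
  have h1 := natr_div_le R j w.
  have h2 : k * y <= k * (j%:R + 1) by rewrite ler_wpM2l // ltW.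
  have h3 : k * (m%:R * s^-1) - c0%:R <= k * y.
    have -> : k * y = k * (m%:R * s^-1) - k * (c0%:R * s^-1) by rewrite -mulrBr -mulrBl.
    have h4 : k * (c0%:R * s^-1) <= c0%:R * s^-1.
      by rewrite ler_piMl // mulr_ge0 // ltW.
    have h5 : c0%:R * s^-1 <= c0%:R :> R by rewrite ler_piMr // ltW.
    lra.
  have h6 : k * (j%:R + 1) = j%:R + 1 - j%:R / w%:R - w%:R^-1 by rewrite /k; ring.
  lra.
exists j; split.
- by apply: leq_trans main; rewrite addn_gt0 e0.
- apply: leq_trans (_ : 2 ^ (w + j %/ w) * 2 ^ (q - c) <= _)%N.
    by rewrite ltn_pmul2r ?expn_gt0 // ltn_exp_div.
  by rewrite -expnD leq_exp2l // addnC.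
- apply: (@lt_le_trans _ _ (2 `^ c0%:R * 2 `^ (- m%:R))).
    by rewrite ltr_pM2r ?powR_gt0 // powR_mulrn.
  rewrite -powRD ?pnatr_eq0 ?implybT // ler_powR ?ler1n //.
  lra.
Qed.

(* [zeta_of (prime_product T) s > 0.x * zeta s] is witnessed at stage [k] by the
   bounds obtained from the integers up to [L^h]. *)
Definition witness (T : TM) (sa : nat -> nat) h (x : string) k L : bool :=
  (binary_value x * (upper_sum sa (L ^ h).+1 k * L + h * 2 ^ k) <
   lower_sum sa (stage T k) (L ^ h).+1 k * L * 2 ^ size x)%N.

(** A single parameter [k] bounds the simulation time, the precision and the cut-off [L], so that
    one minimisation performs the search. *)
Definition found T sa h x k : bool := has (witness T sa h x k) (iota 0 k).

(** Multiplication by [2^|x| * 2^k * L] clears the denominators. *)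
Lemma witnessP (R : realType) T sa h x k L : (0 < L)%N -> witness T sa h x k L =
  ((binary_value x)%:R / 2 ^+ size x *
     ((upper_sum sa (L ^ h).+1 k)%:R / 2 ^+ k + h%:R / L%:R) <
   (lower_sum sa (stage T k) (L ^ h).+1 k)%:R / 2 ^+ k :> R).
Proof.
move=> L0; have LR : 0 < L%:R :> R by rewrite ltr0n.
have M0 : 0 < 2 ^+ size x :> R by rewrite exprn_gt0.
have D0 : 0 < 2 ^+ k :> R by rewrite exprn_gt0.
have MDL : 0 < 2 ^+ size x * 2 ^+ k * L%:R :> R by rewrite !mulr_gt0.
rewrite /witness -(ltr_nat R) -[RHS](ltr_pM2r MDL) !natrM natrD !natrM !natrX.
congr (_ < _); field; by rewrite !gt_eqF.
Qed.

Lemma cmp_root_pow A (eA : enc A) (n e l : A -> nat) :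
  cmp n -> cmp e -> cmp l -> cmp (fun a => root_pow (n a) (e a) (l a)).
Proof.
move=> hn he hl; rewrite /root_pow; apply: cmp_sum; first by cmp_auto.
have c1 (f : A -> nat) : cmp f -> cmp (fun p : A * nat => f p.1).
  by move=> hf; apply: (cmp_comp (f := fst) hf); cmp_auto.
have := c1 _ hn; have := c1 _ he; have := c1 _ hl => h1 h2 h3.
by cmp_auto.
Qed.

Lemma cmp_witness T sa h A (eA : enc A) (x : A -> string) (k L : A -> nat) :
  cmp sa -> cmp x -> cmp k -> cmp L ->
  cmp (fun a => witness T sa h (x a) (k a) (L a)).
Proof.
move=> hsa hx hk hL.
have c1 (f : A -> nat) : cmp f -> cmp (fun p : A * nat => f p.1).
  by move=> hf; apply: (cmp_comp (f := fst) hf); cmp_auto.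
have hk1 := c1 _ hk; have hs1 := cmp_comp hsa hk1.
have hU : cmp (fun a => upper_sum sa (L a ^ h).+1 (k a)).
  apply: (@cmp_ext _ _ _ _
    (fun a => \sum_(0 <= i < L a ^ h) upper_pow sa i.+1 (k a))%N).
    by move=> a /=; rewrite /upper_sum big_add1.
  apply: cmp_sum; first by cmp_auto.
  by apply: cmp_succ; apply: cmp_root_pow; cmp_auto.
have hB : cmp (fun a => lower_sum sa (stage T (k a)) (L a ^ h).+1 (k a)).
  apply: (@cmp_ext _ _ _ _ (fun a => \sum_(0 <= i < L a ^ h)
      (if stage T (k a) i.+1 then lower_pow sa i.+1 (k a) else 0))%N).
    by move=> a /=; rewrite /lower_sum [RHS]big_mkcond big_add1.
  apply: cmp_sum; first by cmp_auto.
  apply: cmp_if; [by apply: cmp_stage; cmp_auto| |by cmp_auto].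
  by apply: cmp_root_pow; cmp_auto.
have hv := cmp_binary_value hx.
by apply: cmp_leq; cmp_auto.
Qed.

Lemma cmp_found T sa h A (eA : enc A) (x : A -> string) (k : A -> nat) :
  cmp sa -> cmp x -> cmp k -> cmp (fun a => found T sa h (x a) (k a)).
Proof.
move=> hsa hx hk; apply: cmp_has => //; apply: cmp_witness => //; last by cmp_auto.
  by apply: (cmp_comp (f := fst) hx); cmp_auto.
by apply: (cmp_comp (f := fst) hk); cmp_auto.
Qed.

Section Search.
Context {R : realType} (T : TM) (s : R) (sa : nat -> nat) (h : nat).
Hypotheses (s1 : 1 < s) (h0 : (0 < h)%N) (hs : 1 + h%:R^-1 <= s).
Hypothesis hsa : forall l, `|s - (sa l)%:R / 2 ^+ l.+1| <= 2 ^- l.+1.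

Let S : pred nat := fun n => `[< dom (prime_product T) (bin n) >].
Let s0 : 0 <= s := ltW (lt_trans ltr01 s1).

Lemma found_ex x :
  (binary_value x)%:R / 2 ^+ size x * zlim s xpredT < zlim s S ->
  exists k, found T sa h x k.
Proof.
move=> lt; have q0 : 0 <= (binary_value x)%:R / 2 ^+ size x :> R.
  by rewrite divr_ge0 ?exprn_ge0.
have [L L0 [k1 _ hk1]] := search_near s0 hsa h0 hs q0 lt.
have [k2 hk2] := stage_near T (L ^ h).+1.
(* Late enough for the dyadic bounds to be sharp, for the whole of [S] up to [L^h] to be found, and
   for [L] to be tried. *)
pose k := maxn (maxn k1 k2) L.+1.
have k1k : (k1 <= k)%N by rewrite /k !leq_max leqnn.
have k2k : (k2 <= k)%N by rewrite /k !leq_max leqnn orbT.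
exists k; apply/hasP; exists L; first by rewrite mem_iota /k !leq_max leqnn orbT.
rewrite (witnessP R) //; apply: lt_le_trans (hk1 k k1k) _.
rewrite ler_wpM2r ?invr_ge0 ?exprn_ge0 // ler_nat /lower_sum.
rewrite big_mkcond [leqRHS]big_mkcond /= big_seq [leqRHS]big_seq.
apply: leq_sum => n; rewrite mem_index_iota => nN.
by case: (boolP (S n)) => // /asboolP /(hk2 k n k2k nN) ->.
Qed.

(* A program [w] missed at stage [k] accounts for a prime [p] absent from the
   lower bound, although [p^-s] exceeds the uncertainty [2^-m zeta s]. *)
Lemma found_halted x k w j : found T sa h x k ->
  zlim s S <= ((binary_value x)%:R / 2 ^+ size x + 2 ^- size x) * zlim s xpredT ->
  (0 < j)%N -> (j * 2 ^ (size w).+1 <= 2 ^ j)%N ->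
  zlim s xpredT * 2 `^ (- (size x)%:R) < 2 `^ (- (j%:R * s)) ->
  dom T w -> halted (run k (init T w)).
Proof.
move=> /hasP[L]; rewrite mem_iota => _ wit up j0 jw small dw.
(* At [L = 0] the right side of the strict inequality is 0. *)
have L0 : (0 < L)%N.
  by move: wit; rewrite /witness; case: L => //; rewrite !muln0 mul0n ltn0.
rewrite (witnessP R) // in wit.
set i := unbin w; have i0 : (0 < i)%N := unbin_gt0 w.
set p := nth_prime i; have pp : prime p by apply: prime_nth_prime.
have p0 : (0 < p)%N by rewrite prime_gt0.
set N := (L ^ h).+1.
have [pN|pN] := boolP (stage T k p && (p < N)%N).
  have /andP[/(stageP _ _ p0)/(_ i i0 (dvdnn _)) + _] := pN.
  by rewrite binK.
exfalso.
have Sp : S p.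
  apply/asboolP/dom_prime_product => // i' i'0.
  rewrite dvdn_prime2 ?prime_nth_prime // => /eqP /nth_prime_inj ->.
  by rewrite binK.
have lt1 : zsum s (stage T k) N + p%:R `^ (- s) <= zlim s S.
  (* With the condition [n < N] in the predicate, [p] fails it both when it was not found and when
     it lies beyond the cut-off. *)
  have -> : zsum s (stage T k) N = zsum s (fun n => stage T k n && (n < N)%N) N.
    rewrite /zsum big_nat_cond [RHS]big_nat_cond; apply: eq_bigl => n.
    by case: (n < N)%N; rewrite ?andbT ?andbF.
  apply: (zsum_lt_lim h0 hs _ p0 Sp pN) => n n0 /andP[/(stage_dom n0) dn _].
  exact/asboolP.
have le1 := lower_sum_le s0 hsa (stage T k) N k.
have le2 : (binary_value x)%:R / 2 ^+ size x * zlim s xpredT <=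
    (binary_value x)%:R / 2 ^+ size x *
     ((upper_sum sa N k)%:R / 2 ^+ k + h%:R / L%:R) :> R.
  rewrite ler_wpM2l ?divr_ge0 ?exprn_ge0 //.
  apply: (le_trans (zlim_le h0 hs xpredT L0)).
  by rewrite lerD2r (upper_sum_ge s0 hsa).
have pj : (p <= 2 ^ j)%N.
  apply: nth_prime_le => //; apply: leq_trans jw.
  by rewrite ltn_pmul2l // unbin_lt.
have ps : 2 `^ (- (j%:R * s)) <= p%:R `^ (- s) :> R.
  rewrite !powRN powRrM powR_mulrn // lef_pV2 ?posrE ?powR_gt0 ?exprn_gt0 ?ltr0n //.
  by rewrite ge0_ler_powR ?nnegrE ?exprn_ge0 // -natrX ler_nat.
have e2 : 2 `^ (- (size x)%:R) = 2 ^- size x :> R by rewrite powRN powR_mulrn.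
(* The lower sum exceeds [0.x * zeta s], so [p^-s] is less than [2^-m * zeta s], with [m = size x];
   but this is less than [2^(-js) <= p^-s]. *)
rewrite mulrDl in up; rewrite e2 mulrC in small.
lra.
Qed.

Lemma zlim_prime_product_gt0 : 0 < zlim s S.
Proof.
apply: lt_le_trans (zsum_le_lim h0 hs S 2); rewrite /zsum big_mkcond big_nat1.
rewrite ifT ?powR_gt0 ?ltr0n //; apply/asboolP/dom_prime_product => // i i0.
by rewrite dvdn1 => /eqP E; have := prime_nth_prime i0; rewrite E.
Qed.

(** A string outside the domain of [T] keeps the corresponding prime, and its positive term, out of
    the sum over [S]. *)
Lemma zlim_prime_product_lt : universal T (fun=> True) -> zlim s S < zlim s xpredT.
Proof.
move=> /universal_not_total[x nx]; set i := unbin x.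
have i0 : (0 < i)%N := unbin_gt0 x.
have p0 : (0 < nth_prime i)%N by rewrite prime_gt0 // prime_nth_prime.
have nS : ~~ S (nth_prime i).
  apply/negP => /asboolP /(dom_prime_product _ p0) /(_ i i0 (dvdnn _)).
  by rewrite binK.
have pp : 0 < (nth_prime i)%:R `^ (- s) :> R by rewrite powR_gt0 ?ltr0n.
have : zlim s S <= zlim s xpredT - (nth_prime i)%:R `^ (- s).
  apply: limr_le; first exact: (zsum_cvg h0 hs).
  near=> N; rewrite lerBrDr; exact: (zsum_lt_lim h0 hs).
lra.
Unshelve. all: by end_near.
Qed.

End Search.

(** * The search started from a program for a prefix *)

Record output_prefix (T : TM) (d : nat -> bool) := OutputPrefix {
  program : string;
  prefix : string;
  program_computes : computes T program prefix;
  prefixE : prefix = mkseq d (size prefix) }.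

#[local] Instance enc_output_prefix T d : enc (output_prefix T d) :=
  Enc (fun a => program a).

Theorem theorem45 (R : realType) (T : TM) (s : R)
    (hT : universal T (fun=> True))
    (hs : computable_real s) (hs1 : 1 < s) :
  asymptotically_random T s (zeta_of (prime_product T) s / zeta s).
Proof.
(* Chosen so that [1/h <= s - 1]. *)
pose h := (Num.trunc (1 / (s - 1))).+1.
have h0 : (0 < h)%N by [].
have hh : 1 + h%:R^-1 <= s.
  rewrite -lerBrDl -[leRHS]invrK lef_pV2 ?posrE ?invr_gt0 ?ltr0n ?subr_gt0 //.
  by rewrite -[leLHS]mul1r ltW // ltr_truncS // divr_ge0 //; lra.
have [sa csa hsa] := computable_real_approx hs hs1.
pose S : pred nat := fun n => `[< dom (prime_product T) (bin n) >].
have S0 : 0 < zlim s S by exact: (zlim_prime_product_gt0 T h0 hh).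
have SZ : zlim s S < zlim s xpredT by exact: (zlim_prime_product_lt h0 hh hT).
have Z0 : 0 < zlim s xpredT by lra.
have -> : zeta_of (prime_product T) s / zeta s = zlim s S / zlim s xpredT by [].
set alpha := zlim s S / zlim s xpredT.
have alphaZ : alpha * zlim s xpredT = zlim s S by rewrite divfK // gt_eqF.
have a01 : 0 < alpha < 1 by rewrite divr_gt0 //= ltr_pdivrMr // mul1r.
split=> //; have [d hd bd] := unending_expansion_ex a01; exists d => // t _ st.
have [u [v [c [v0 huv]]]] := exponent_choice hs1 st Z0.
pose e (a : output_prefix T d) := (size (prefix a) * u %/ v - c)%N.
have ex_k (a : output_prefix T d) : exists k, found T sa h (prefix a) k.
  apply: (found_ex hs1 h0 hh hsa); rewrite -alphaZ ltr_pM2r //.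
  by rewrite {1}(prefixE a); have [] := bd (size (prefix a)).
pose k a := ex_minn (ex_k a).
(* The code holds only the program; the prefix is recovered by running [T] on it. *)
have cprefix : cmp (@prefix T d).
  apply: (@cmp_eval T _ _ (@program T d)); last exact: program_computes.
  by apply: (@cmp_unraw _ _ (fun a => Raw (program a))); exact: cmp_code.
have ce : cmp e.
  by apply: cmp_sub; [apply: cmp_divn => //|]; cmp_auto.
have ck : cmp k.
  apply: (@cmp_search _ _ (fun a k => found T sa h (prefix a) k)).
  - apply: cmp_found => //; cmp_auto.
    by apply: (cmp_comp (f := fst) cprefix); cmp_auto.
  - by move=> a; rewrite /k; case: ex_minnP.
  - move=> a m; rewrite /k; case: ex_minnP => n _ hn mn.
    by apply/negP => /hn; rewrite leqNgt mn.
have [|c1 hc1] := incompressible hT ce ck.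
  move=> a w we dw.
  have [_] := huv (size (prefix a)); rewrite -/(e a) => /(_ (leq_ltn_trans (leq0n _) we)).
  move=> [j [j0 je jZ]].
  apply: (found_halted hs1 h0 hh hsa _ _ j0 _ jZ) => //.
  - by rewrite /k; case: ex_minnP.
  - rewrite -alphaZ ler_pM2r //.
    by rewrite {1}(prefixE a); have [] := bd (size (prefix a)).
  - by apply: leq_trans (ltnW je); rewrite leq_mul2l leq_exp2l // we orbT.
(* [c.+1] is the loss in [exponent_choice], and [c1] the overhead of universality. *)
exists (c.+1 + c1)%:R => // m m0.
apply: le_ereal_inf_tmp => _ [w hw <-]; rewrite lee_fin.
have pE : mkseq d m = mkseq d (size (mkseq d m)) by rewrite size_mkseq.
have := hc1 (OutputPrefix hw pE); rewrite /e /= size_mkseq.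
have [+ _] := huv m; rewrite -(ler_nat R) !natrD.
lra.
Qed.
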